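(* Let $K$ be an algebraically closed field and let $X,Y\in\mathcal{S}_a^b(K)$. The following conditions are equivalent: (1) $X\leq_{\rm dom}Y$; (2) $X\leq_{\rm deg}Y$; (3) $X\leq_{\rm hom}Y$.
   Context: For a partition $\lambda=(\lambda_1\ge\lambda_2\ge\dots)$ put $N_\lambda=\bigoplus_iK[T]/(T^{\lambda_i})$ and $|\lambda|=\sum_i\lambda_i$. $\mathcal{S}=\mathcal{S}(K)$ is the category of triples $(N_\alpha,N_\beta,f)$ with $f:N_\alpha\to N_\beta$ an injective $K[T]$-homomorphism; morphisms $(N_\alpha,N_\beta,f)\to(N_{\alpha'},N_{\beta'},f')$ are pairs $(\psi_1,\psi_2)$ of $K[T]$-homomorphisms with $f'\psi_1=\psi_2f$. $\mathcal{S}_1$ is the full subcategory of objects with $\alpha_1\le1$, and $\mathcal{S}_a^b$ the full subcategory of $\mathcal{S}_1$ of objects with $|\alpha|=a$, $|\beta|=b$. Every indecomposable object of $\mathcal{S}_1$ is isomorphic to $P_0^m=(0,N_{(m)},0)$ or $P_1^m=(N_{(1)},N_{(m)},\iota)$ with $\iota(1)=T^{m-1}$, $m\ge1$. An object $X$ of $\mathcal{S}_1$ is determined up to isomorphism by a pair of partitions $\gamma^X\subseteq\beta^X$ with $\gamma^X_i\le\beta^X_i\le\gamma^X_i+1$ for all $i$: $X\cong\bigoplus_iP_{\varepsilon_i}^{\beta^X_i}$ with $\varepsilon_i=\beta^X_i-\gamma^X_i$. Orders on $\mathcal{S}_a^b$: - For partitions with $|\lambda|=|\mu|$, $\lambda\leq_{\rm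 nat}\mu$ means $\sum_{i=1}^k\lambda_i\ge\sum_{i=1}^k\mu_i$ for all $k$. $X\leq_{\rm dom}Y$ means $\beta^X\leq_{\rm nat}\beta^Y$ and $\gamma^X\leq_{\rm nat}\gamma^Y$. - $X\leq_{\rm hom}Y$ means $\dim_K\operatorname{Hom}_{\mathcal{S}}(Z,X)\le\dim_K\operatorname{Hom}_{\mathcal{S}}(Z,Y)$ for every object $Z$ of $\mathcal{S}$. - ${}^aV^b$ is the set of $(f,\varphi)\in\mathbb{M}_{b\times a}(K)\times\mathbb{M}_b(K)$ with $\varphi^b=0$, $\varphi f=0$, $f$ of maximal rank, with the induced Zariski topology; $\mathrm{Gl}(a)\times\mathrm{Gl}(b)$ acts by $(g,h)\cdot(f,\varphi)=(hfg^{-1},h\varphi h^{-1})$. Objects $X$ of $\mathcal{S}_a^b$ are identified with points of ${}^aV^b$ (by choosing bases; isomorphism classes correspond to orbits $\mathcal{O}_X$). $X\leq_{\rm deg}Y$ means $\mathcal{O}_Y\subseteq\overline{\mathcal{O}_X}$, closure taken in ${}^aV^b$. *)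

(* Defs.v *)
From HB Require Import structures.
From mathcomp Require Import all_boot all_order all_algebra.
From mathcomp Require Import mpoly.

Set Implicit Arguments.
Unset Strict Implicit.
Unset Printing Implicit Defensive.

Import GRing.Theory.
Local Open Scope ring_scope.

(* Conventions.  Vectors are columns and linear maps act on the left.  A finite
   dimensional K[T]-module is a space K^n together with the n x n matrix of the
   action of T, so a K[T]-homomorphism is a matrix intertwining the actions. *)

(* Zero parts are dropped, so that equal partitions are equal sequences. *)
Record partition := Partition {
  parts :> seq nat;
  _ : sorted geq parts && (0%N \notin parts) }.

(* The part of index i, counted from 0; it is 0 beyond the last nonzero part. *)
Definition part (lam : partition) (i : nat) : nat := nth 0%N lam i.

Definition weight (lam : partition) : nat := (\sum_(i < size lam) part lam i)%N.

Definition nat_le (lam mu : partition) : Prop :=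
  weight lam = weight mu /\
  forall k : nat, (\sum_(i < k) part mu i <= \sum_(i < k) part lam i)%N.

Section Modules.
Variable K : fieldType.

(* Action of T on K[T]/(T^m) in the basis 1, T, ..., T^(m-1). *)
Definition cyclicT (m : nat) : 'M[K]_m :=
  \matrix_(r, c) (r == c.+1 :> nat)%:R.

Lemma cyclicTE (m : nat) (p : {poly K}) :
  cyclicT m *m (poly_rV p)^T = (poly_rV (('X * p) %% 'X^m))^T.
Proof.
apply/matrixP => r j; rewrite !mxE.
have -> : (('X * p) %% 'X^m)`_r = ('X * p)`_r.
  by rewrite {2}(divp_eq ('X * p) 'X^m) coefD coefMXn ltn_ord add0r.
rewrite coefXM; case: (posnP r) => [r0|r_gt0].
  by rewrite big1 // => c _; rewrite !mxE r0 mul0r.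
have lt_r : (r.-1 < m)%N by apply: leq_ltn_trans (leq_pred _) (ltn_ord r).
rewrite (bigD1 (Ordinal lt_r)) //= !mxE /= prednK // eqxx mul1r.
rewrite big1 ?addr0 // => c; rewrite -val_eqE /= => ne.
rewrite !mxE -(prednK r_gt0) eqSS eq_sym.
by rewrite (negPf ne) mul0r.
Qed.

Definition NT (lam : partition) : 'M[K]_(weight lam) :=
  \mxdiag_(i < size lam) cyclicT (part lam i).

(* emb is not required here to commute with T or to be injective; both
   conditions are part of Sobj. *)
Record triple := Triple {
  dim1 : nat;
  dim2 : nat;
  T1 : 'M[K]_dim1;
  T2 : 'M[K]_dim2;
  emb : 'M[K]_(dim2, dim1) }.

Local Notation homT X Y :=
  ('M[K]_(dim1 Y, dim1 X) * 'M[K]_(dim2 Y, dim2 X))%type.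

Definition is_hom (X Y : triple) (psi : homT X Y) : Prop :=
  [/\ psi.1 *m T1 X = T1 Y *m psi.1,
      psi.2 *m T2 X = T2 Y *m psi.2
    & emb Y *m psi.1 = psi.2 *m emb X].

Definition hom_defect (X Y : triple) (psi : homT X Y) :
    'M[K]_(dim1 Y, dim1 X) * 'M[K]_(dim2 Y, dim2 X) * 'M[K]_(dim2 Y, dim1 X) :=
  (psi.1 *m T1 X - T1 Y *m psi.1, psi.2 *m T2 X - T2 Y *m psi.2,
   emb Y *m psi.1 - psi.2 *m emb X).

Lemma hom_defect_is_linear (X Y : triple) : linear (@hom_defect X Y).
Proof.
move=> k u v; rewrite /hom_defect /=.
by congr (_, _, _); rewrite /= !(mulmxDl, mulmxDr) -!(scalemxAl, scalemxAr)
   opprD addrACA scalerBr.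
Qed.

HB.instance Definition _ X Y :=
  GRing.isLinear.Build K _ _ _ (@hom_defect X Y) (@hom_defect_is_linear X Y).

Definition HomS (X Y : triple) : {vspace homT X Y} :=
  lker (linfun (@hom_defect X Y)).

Lemma HomSP (X Y : triple) (psi : homT X Y) :
  reflect (is_hom psi) (psi \in HomS X Y).
Proof.
rewrite memv_ker lfunE /=; apply: (iffP eqP) => [[] |[e1 e2 e3]].
  by move=> /subr0_eq e1 /subr0_eq e2 /subr0_eq e3.
by rewrite /hom_defect e1 e2 e3 !subrr.
Qed.

Definition isomorphic (X Y : triple) : Prop :=
  exists (psi : homT X Y) (chi : homT Y X),
    [/\ is_hom psi, is_hom chi,
        chi.1 *m psi.1 = 1%:M /\ psi.1 *m chi.1 = 1%:M
      & chi.2 *m psi.2 = 1%:M /\ psi.2 *m chi.2 = 1%:M].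

(* The (i, i) block of the map is that of the i-th summand; conform_mx only
   casts its dimensions along i = j. *)
Definition dsum (n : nat) (X : 'I_n -> triple) : triple :=
  @Triple (\sum_(i < n) dim1 (X i))%N (\sum_(i < n) dim2 (X i))%N
    (\mxdiag_(i < n) T1 (X i))
    (\mxdiag_(i < n) T2 (X i))
    (\mxblock_(i < n, j < n)
       (if i == j then conform_mx 0 (emb (X i)) else 0)).

(* P_eps^m for eps in {0, 1}: the generator of K[T]/(T^eps), if there is one,
   is sent to T^(m-1). *)
Definition picket (eps m : nat) : triple :=
  @Triple eps m (cyclicT eps) (cyclicT m)
    (\matrix_(r < m, c < eps) (r.+1 == m :> nat)%:R).

Record Sobj := SObj {
  alpha : partition;
  beta : partition;
  Smap : 'M[K]_(weight beta, weight alpha);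
  Smap_lin : Smap *m NT alpha = NT beta *m Smap;
  Smap_inj : injective (fun v : 'cV[K]_(weight alpha) => Smap *m v) }.

Definition triple_of (X : Sobj) : triple :=
  Triple (NT (alpha X)) (NT (beta X)) (Smap X).

Record Sab (a b : nat) := SAb {
  Sab_obj : Sobj;
  Sab_alpha1 : (part (alpha Sab_obj) 0 <= 1)%N;
  Sab_alpha : weight (alpha Sab_obj) = a;
  Sab_beta : weight (beta Sab_obj) = b }.

(* The size of be is the number of nonzero parts, so each summand P_eps^m below
   has m >= 1 and eps in {0, 1}; (be, ga) is the pair (beta^X, gamma^X). *)
Definition has_type (X : Sobj) (be ga : partition) : Prop :=
  (forall i : nat, (part ga i <= part be i <= (part ga i).+1)%N) /\
  isomorphic (triple_of X)
    (dsum (fun i : 'I_(size be) =>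
             picket (part be i - part ga i) (part be i))).

(* Every object of S_1 has exactly one pair, so quantifying existentially
   amounts to naming beta^X, gamma^X, beta^Y and gamma^Y. *)
Definition dom_le (a b : nat) (X Y : Sab a b) : Prop :=
  exists beX gaX beY gaY : partition,
    [/\ has_type (Sab_obj X) beX gaX, has_type (Sab_obj Y) beY gaY,
        nat_le beX beY & nat_le gaX gaY].

Definition hom_le (a b : nat) (X Y : Sab a b) : Prop :=
  forall Z : Sobj,
    (\dim (HomS (triple_of Z) (triple_of (Sab_obj X)))
     <= \dim (HomS (triple_of Z) (triple_of (Sab_obj Y))))%N.

Section Degeneration.
Variables a b : nat.

Local Notation space := ('M[K]_(b, a) * 'M[K]_b)%type.

Definition coords (p : space) (i : 'I_(b * a + b * b)) : K :=
  row_mx (mxvec p.1) (mxvec p.2) 0 i.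

Definition variety (p : space) : Prop :=
  [/\ p.2 ^+ b = 0, p.2 *m p.1 = 0 & \rank p.1 = minn a b].

Definition GL_act (g : 'M[K]_a) (h : 'M[K]_b) (p : space) : space :=
  (h *m p.1 *m invmx g, h *m p.2 *m invmx h).

Definition GL_orbit (p q : space) : Prop :=
  exists (g : 'M[K]_a) (h : 'M[K]_b),
    [/\ g \in unitmx, h \in unitmx & q = GL_act g h p].

Definition zariski_closed (C : space -> Prop) : Prop :=
  exists I : {mpoly K[b * a + b * b]} -> Prop,
    forall p : space,
      C p <-> variety p /\ forall P, I P -> P.@[coords p] = 0.

Definition zariski_closure (A : space -> Prop) (p : space) : Prop :=
  variety p /\
  forall C, zariski_closed C -> (forall q, A q -> C q) -> C p.

Definition point_of (X : Sab a b) : space :=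
  (castmx (Sab_beta X, Sab_alpha X) (Smap (Sab_obj X)),
   castmx (Sab_beta X, Sab_beta X) (NT (beta (Sab_obj X)))).

Definition deg_le (X Y : Sab a b) : Prop :=
  forall p, GL_orbit (point_of Y) p -> zariski_closure (GL_orbit (point_of X)) p.

End Degeneration.

End Modules.

(* Main.v *)
From HB Require Import structures.
Require Import Defs.
From mathcomp Require Import all_boot all_order all_algebra.
From mathcomp Require Import mpoly zify.

(** An object of S_1 is a nilpotent operator [phi] together with an injective map
    [f] whose image is killed by [phi].  It is a direct sum of pickets
    ([adapted_step], [code_of_point]), and the picket P_eps^m is recorded by the
    single number [c = 2m - eps], its code: then [m] is [uphalf c] and [m - eps] is
    [c./2].  Thus an object is a list of nonzero codes, with [b] the sum of the
    [uphalf c] and [a] the number of odd codes.  The partitions [beta] and [gamma]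
    are obtained by rounding up and down, and the two dominance conditions together
    are the inequality of the numbers [tailsum n] for all [n], with equality at 0
    and 1 ([tailsum_code_dom]).

    Dominance implies degeneration.  Comparing the second differences of the tail
    sums shows that a list of codes which strictly dominates another one still
    dominates it after two suitable codes [c > d] have been brought closer together
    ([exists_move]); the move can be chosen so that its result is a direct sum A + B
    and the object it starts from is a nonsplit extension of B by A.  Scaling the
    extension by [t] gives a line of points which lie in the orbit of the extension
    for [t != 0] and which passes through A + B at [t = 0] ([degen_family]); a
    polynomial that vanishes on the orbit vanishes at [t = 0] too
    ([closure_line]).  Hence induction on the moves gives [dom_closure].

    Degeneration implies the hom order, because Hom(Z, X) is the kernel of a linear
    map whose coefficients are polynomials in the coordinates of the point X, and
    the dimension of such a kernel can only jump up in the closure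
    ([closure_dim_ker]).

    The hom order implies dominance, by testing on the pickets only:
    Hom(P_0^m, X) is the kernel of [phi ^+ m], and Hom(P_1^m, X) is the space of
    the pairs [(x, y)] with [phi ^+ (m - 1) x = f y].  By rank-nullity, a chain
    basis of X expresses their dimensions through the tail sums of the codes of X
    ([dim_limg_power], [dim_limg_rel_map]). *)

Set Implicit Arguments.
Unset Strict Implicit.
Unset Printing Implicit Defensive.

Import GRing.Theory.

(** * Lists of codes and their tail sums *)
Definition nzparts (s : seq nat) : seq nat := [seq c <- s | c != 0].

(** A list of codes [c] stands for the partitions [beta] and [gamma] with parts
    [uphalf c] and [c./2].  The tail sum at [n = 2m] is the sum of the parts of
    [beta] in excess of [m], and at [n = 2m + 1] the same for [gamma], so one
    sequence of numbers records both dominance orders. *)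
Definition tailsum (n : nat) (s : seq nat) : nat := \sum_(c <- s) (c.+1 - n)./2.

Lemma tailsum_cons n c s : tailsum n (c :: s) = (c.+1 - n)./2 + tailsum n s.
Proof. by rewrite /tailsum big_cons. Qed.

Lemma perm_tailsum n s s' : perm_eq s s' -> tailsum n s = tailsum n s'.
Proof. exact: perm_big. Qed.

Lemma tailsum_nzparts n s : tailsum n (nzparts s) = tailsum n s.
Proof.
elim: s => // c s IHs; rewrite /nzparts /=.
case: ifP => [_|/eqP->]; rewrite !tailsum_cons IHs //.
by case: n {IHs} => [|n].
Qed.

(** This mixed second difference of the tail sums sees only the codes equal to
    [n].  Hence the tail sums determine the nonzero codes, and a difference of two
    sequences of tail sums can be strictly convex, in this sense, only at a code of
    the first list. *)
Lemma count_tailsum n s : 0 < n ->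
  count_mem n s + tailsum n s + tailsum n.+1 s
  = tailsum n.+2 s + tailsum n.-1 s.
Proof.
move=> n_gt0; elim: s => [|c s IHs]; first by rewrite /tailsum !big_nil.
have eq_c : (c == n) + (c.+1 - n)./2 + (c.+1 - n.+1)./2
  = (c.+1 - n.+2)./2 + (c.+1 - n.-1)./2 by case: eqP => /=; lia.
rewrite !tailsum_cons [RHS]addnACA -eq_c -IHs /=.
move: (c == n : nat) (count _ s) => u v; lia.
Qed.

Lemma tailsum_large s : exists N, forall n, N <= n -> tailsum n s = 0.
Proof.
elim: s => [|c s [N hN]]; first by exists 0 => n _; rewrite /tailsum big_nil.
exists (N + c.+1) => n hn; rewrite tailsum_cons hN; lia.
Qed.

Lemma perm_mem2 (s : seq nat) c d :
  c \in s -> d \in s -> c != d -> exists r, perm_eq s [:: c, d & r].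
Proof.
move=> cs ds cd; exists (rem d (rem c s)).
apply: perm_trans (perm_to_rem cs) _; rewrite perm_cons; apply: perm_to_rem.
by have := perm_mem (perm_to_rem cs) d; rewrite ds inE eq_sym (negPf cd).
Qed.

(** The combinatorial heart: if [s] strictly dominates [s'], two codes of [s],
    the smaller one possibly zero, can be brought closer together without losing
    dominance.  The conclusion has the shape required by [degen_family]: the codes
    [al + e - d] and [d] become [al] and [e], with [d] and [e] of the same parity. *)
Lemma exists_move s s' :
    (forall n, tailsum n s' <= tailsum n s) ->
    tailsum 0 s' = tailsum 0 s -> tailsum 1 s' = tailsum 1 s ->
    (exists n, tailsum n s' < tailsum n s) ->
  exists al e d r,
    [/\ perm_eq (nzparts s) (nzparts [:: al + e - d, d & r]),
        d < al, d < e, odd d = odd e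
      & [/\ forall n, tailsum n s' <= tailsum n [:: al, e & r],
        tailsum 0 s' = tailsum 0 [:: al, e & r]
      & tailsum 1 s' = tailsum 1 [:: al, e & r]]].
Proof.
move=> le_s eq0 eq1 ex_lt.
have [P ltP minP] := ex_minnP ex_lt.
have D0 n : n < P -> tailsum n s' = tailsum n s.
  by have := le_s n; have := minP n; case: ltngtP => //; lia.
have P_ge2 : 2 <= P by case: P ltP {minP D0} => [|[|P]] //; lia.
(* With D n the difference of the tail sums of s and s' at n, a number c that is
   not a part of s satisfies D (c+2) + D (c-1) <= D c + D (c+1).  P is the first
   index with D P > 0, and the smaller code to be moved is d = P - 2. *)
have no_part c : 0 < c -> c \notin s ->
    tailsum c.+2 s + tailsum c.-1 s + tailsum c s' + tailsum c.+1 s'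
    <= tailsum c.+2 s' + tailsum c.-1 s' + tailsum c s + tailsum c.+1 s.
  move=> c_gt0 /count_memPn cs.
  by have := count_tailsum s c_gt0; have := count_tailsum s' c_gt0; lia.
have [N hN] : exists N, forall n, N <= n ->
    tailsum n s = 0 /\ tailsum n s' = 0.
  have [N1 h1] := tailsum_large s; have [N2 h2] := tailsum_large s'.
  by exists (N1 + N2) => n hn; split; [apply: h1 | apply: h2]; lia.
(* The code P - 2 is a part of s, unless it is zero. *)
have part_d c : c \in s -> P < c -> exists r,
    perm_eq (nzparts s) (nzparts [:: c, P.-2 & r]).
  move=> cs ltPc; have [d0|d_gt0] := posnP P.-2.
    exists (rem c s); rewrite d0.
    by apply: perm_trans (perm_filter _ (perm_to_rem cs)) _; rewrite /nzparts /=.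
  have ds : P.-2 \in s.
    apply/negPn/negP => /(no_part _ d_gt0).
    have -> : P.-2.+2 = P by lia.
    by have := D0 P.-2; have := D0 P.-2.+1; have := D0 P.-2.-1; lia.
  have [|r hr] := perm_mem2 cs ds; first by lia.
  by exists r; apply: perm_filter.
have tail_s c r n : perm_eq (nzparts s) (nzparts [:: c, P.-2 & r]) ->
    tailsum n s = (c.+1 - n)./2 + ((P.-2.+1 - n)./2 + tailsum n r).
  move=> hr; rewrite -tailsum_nzparts (perm_tailsum _ hr) tailsum_nzparts.
  by rewrite !tailsum_cons.
have [DP1|DP1] : (tailsum P.+1 s' = tailsum P.+1 s) \/
    (tailsum P.+1 s' < tailsum P.+1 s) by have := le_s P.+1; lia.
(* Here D vanishes at P+1.  As long as no c = P+2i+1 is a part, the difference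
   D (P+2i) - D (P+2i+1) cannot decrease with i, so it stays positive; but D
   vanishes at large indices.  Replacing c by c-1 and P-2 by P-1 lowers the tail
   sums by 1 at P, P+2, ..., P+2i and nowhere else. *)
- have [i ci posD] : exists2 i, P + i.*2.+1 \in s &
      forall j, j <= i -> tailsum (P + j.*2) s' < tailsum (P + j.*2) s.
    suff chain i : (exists2 i, P + i.*2.+1 \in s &
        forall j, j <= i -> tailsum (P + j.*2) s' < tailsum (P + j.*2) s) \/
      (forall j, j <= i -> tailsum (P + j.*2) s' < tailsum (P + j.*2) s) /\
      tailsum (P + i.*2) s' + tailsum (P + i.*2).+1 s
        < tailsum (P + i.*2) s + tailsum (P + i.*2).+1 s'.
      have [//|[_]] := chain N.
      have [-> ->] := hN (P + N.*2) ltac:(lia).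
      by have [-> ->] := hN (P + N.*2).+1 ltac:(lia).
    elim: i => [|i [|[posi Fi]]]; [|by left|].
      right; have -> : P + 0.*2 = P by rewrite double0 addn0.
      split=> [j|]; last by lia.
      by rewrite leqn0 => /eqP->; rewrite double0 addn0.
    have [cs|cs] := boolP (P + i.*2.+1 \in s); first by left; exists i.
    right; have {cs} := no_part (P + i.*2.+1) ltac:(lia) cs.
    have -> : P + i.+1.*2 = (P + i.*2).+2 by lia.
    rewrite !addnS /= => no; have leS := le_s (P + i.*2).+3.
    have lt : tailsum (P + i.*2).+2 s' < tailsum (P + i.*2).+2 s by lia.
    split; last by lia.
    move=> j; rewrite leq_eqVlt => /predU1P[->|/posi//].
    by rewrite doubleS !addnS.
  have [r hr] := part_d _ ci ltac:(lia).
  exists P.-1, (P + i.*2), P.-2, r; split; try lia.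
    by have -> : P.-1 + (P + i.*2) - P.-2 = P + i.*2.+1 by lia.
  have tl := tail_s _ _ ^~ hr.
  split.
  + move=> n; have := le_s n; rewrite (tl n) !tailsum_cons.
    have [/andP[hn /andP[hn2 hn3]]|] :=
      boolP [&& P <= n, n <= P + i.*2 & odd (n - P) == false].
      have := posD (n - P)./2 ltac:(lia).
      have -> : P + (n - P)./2.*2 = n by lia.
      rewrite (tl n); lia.
    by lia.
  + rewrite eq0 (tl 0) !tailsum_cons; lia.
  + rewrite eq1 (tl 1) !tailsum_cons; lia.
(* Here D is positive on [P, r], where r > P, and vanishes at r+1.  If neither r
   nor r+1 was a part, the two inequalities of no_part would add up to
   D (r+3) + D (r-1) <= 0.  Replacing the part c found by c-2 and P-2 by P lowers the
   tail sums by 1 on [P, c-1], and nowhere else. *)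
- have [r [hr1 posD Dr]] : exists r, [/\ P < r,
      forall n, P <= n <= r -> tailsum n s' < tailsum n s &
      tailsum r.+1 s' = tailsum r.+1 s].
    have ex : exists n, (P < n) && (tailsum n.+1 s' == tailsum n.+1 s).
      by exists (P + N.+1); have [-> ->] := hN (P + N.+1).+1 ltac:(lia); lia.
    have [r /andP[ltPr /eqP Dr] minr] := ex_minnP ex.
    exists r; split=> // n /andP[le1 le2].
    have [->//|neP] := eqVneq n P; have [->//|neP1] := eqVneq n P.+1.
    have := minr n.-1; have := le_s n; have -> : n.-1.+1 = n by lia.
    by case: eqP; lia.
  have [c cs /andP[hc1 hc2]] : exists2 c, c \in s & r <= c <= r.+1.
    have [rs|rs] := boolP (r \in s); first by exists r => //; lia.
    have [rs1|rs1] := boolP (r.+1 \in s); first by exists r.+1 => //; lia.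
    have := no_part _ _ rs; have := no_part _ _ rs1 => /=.
    have := posD r.-1; have := le_s r.+3; lia.
  have [q hq] := part_d _ cs ltac:(lia).
  exists c.-2, P, P.-2, q; split; try lia.
    by have -> : c.-2 + P - P.-2 = c by lia.
  have tl := tail_s _ _ ^~ hq.
  split.
  + move=> n; have := le_s n; rewrite (tl n) !tailsum_cons.
    have [hn|] := boolP (P <= n < c).
      by have := posD n ltac:(lia); rewrite (tl n); lia.
    by lia.
  + rewrite eq0 (tl 0) !tailsum_cons; lia.
  + rewrite eq1 (tl 1) !tailsum_cons; lia.
Qed.

Lemma eq_tailsum_perm s s' : (forall n, tailsum n s = tailsum n s') ->
  perm_eq (nzparts s) (nzparts s').
Proof.
move=> eq_s; apply/allP => c _ /=; apply/eqP.
have [->|c_gt0] := posnP c; first by rewrite !(count_memPn _) ?mem_filter.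
have eq_count t : count_mem c (nzparts t) = count_mem c t.
  elim: t => // x t IHt; rewrite /nzparts /=.
  case: eqVneq => [->|_] /=; rewrite IHt //.
  by rewrite eq_sym (gtn_eqF c_gt0).
rewrite !eq_count.
have := count_tailsum s c_gt0; have := count_tailsum s' c_gt0.
rewrite !eq_s; lia.
Qed.

(** Induction along the moves of [exists_move].  Each of them decreases the sum of
    the squares of the codes, by [2 (al - d) (e - d)]. *)
Lemma tailsum_ind s' (Q : seq nat -> Prop) :
    (forall s, perm_eq (nzparts s) (nzparts s') -> Q s) ->
    (forall s al e d r, perm_eq (nzparts s) (nzparts [:: al + e - d, d & r]) ->
       d < al -> d < e -> odd d = odd e -> Q [:: al, e & r] -> Q s) ->
  forall s, (forall n, tailsum n s' <= tailsum n s) ->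
    tailsum 0 s' = tailsum 0 s -> tailsum 1 s' = tailsum 1 s -> Q s.
Proof.
move=> Qs' Qmove s; pose sq t := \sum_(c <- t) c * c.
have sq_nz t : sq (nzparts t) = sq t.
  elim: t => // x t; rewrite /sq /nzparts /= big_cons.
  by case: eqP => [->|_] /=; rewrite ?big_cons => ->.
have [k] := ubnP (sq s); elim: k s => // k IHk s lt_k le_s eq0 eq1.
have [N hN] := tailsum_large s.
have [/existsP[n lt_n]|/existsPn all_eq] :=
    boolP [exists n : 'I_N, tailsum n s' < tailsum n s]; last first.
  apply: Qs'; apply: eq_tailsum_perm => n; have := le_s n.
  have [/hN->|ltnN] := leqP N n; first by rewrite leqn0 => /eqP->.
  by have := all_eq (Ordinal ltnN); rewrite -leqNgt /=; lia.
have [|al [e [d [r [perm_s lt_al lt_e odd_d [le_r eq0r eq1r]]]]]] :=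
  exists_move le_s eq0 eq1; first by exists n.
apply: (Qmove s al e d r) => //; apply: IHk => //.
have : sq s = sq [:: al + e - d, d & r].
  by rewrite -sq_nz -[RHS]sq_nz; apply: perm_big.
move: lt_k; rewrite /sq !big_cons; move: (\sum_(c <- r) _) (\sum_(c <- s) _).
have [m ->] : exists m, al = d + m.+1 by exists (al - d.+1); lia.
have [n' ->] : exists n, e = d + n.+1 by exists (e - d.+1); lia.
have -> : d + m.+1 + (d + n'.+1) - d = d + m.+1 + n'.+1 by lia.
move=> u v; nia.
Qed.

(** * Dominance of partitions through tail sums *)
Definition excess (m : nat) (s : seq nat) : nat := \sum_(c <- s) (c - m).

(** The partial sums and the excesses of a partition are Legendre dual:
    [excess m s] is the maximum over [k] of the [k]-th partial sum minus [k * m],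
    reached where the parts cross the value [m]. *)
Lemma psum_le_excess s k m :
  \sum_(i < k) nth 0 s i <= k * m + excess m s.
Proof.
elim: s k => [|c s IHs] [|k]; rewrite ?big_ord0 //.
  by rewrite big1 // => i _; rewrite nth_nil.
rewrite big_ord_recl /excess big_cons mulSn /=.
have := IHs k; rewrite /excess.
move: (\sum_(i < k) _) (k * m) (\sum_(c <- s) _) => u v w; lia.
Qed.

Lemma sorted_geq_nth s i j : sorted geq s -> i <= j -> nth 0 s j <= nth 0 s i.
Proof.
move=> s_s le_ij; have [le_sj|lt_js] := leqP (size s) j.
  by rewrite (nth_default _ le_sj).
have geq_trans : transitive geq by move=> ? ? ? /= h1 h2; apply: leq_trans h2 h1.
have geq_refl : reflexive geq by move=> x /=.
apply: (sorted_leq_nth geq_trans geq_refl 0 s_s) => //.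
by rewrite inE (leq_ltn_trans le_ij).
Qed.

Lemma psum_eq_excess s k m : sorted geq s ->
    (forall i, i < k -> m <= nth 0 s i) -> nth 0 s k <= m ->
  \sum_(i < k) nth 0 s i = k * m + excess m s.
Proof.
elim: s k => [|c s IHs] k s_s ge_m le_m.
  case: k ge_m {le_m} => [|k] ge_m; rewrite /excess ?big_ord0 ?big_nil //.
  have /= := ge_m 0 isT; rewrite leqn0 => /eqP->.
  by rewrite muln0 big1 // => i _; rewrite nth_nil.
case: k ge_m le_m => [|k] ge_m le_m.
  rewrite big_ord0 mul0n add0n /excess big1_seq // => x /(nthP 0)[i lt_i <-].
  by apply/eqP; rewrite subn_eq0 (leq_trans (sorted_geq_nth s_s (leq0n i))).
rewrite big_ord_recl /excess big_cons /= IHs ?(path_sorted s_s) //.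
  have /= := ge_m 0 isT; rewrite /excess mulSn.
  by move: (k * m) (\sum_(c <- s) _) => u v; lia.
by move=> i lt_i; apply: (ge_m i.+1).
Qed.

Lemma excess_dom s t : sorted geq s -> sorted geq t ->
  (forall k, \sum_(i < k) nth 0 t i <= \sum_(i < k) nth 0 s i)
  <-> (forall m, excess m t <= excess m s).
Proof.
move=> s_s s_t; split=> [le_k m|le_m k].
  have ex : exists k, nth 0 t k <= m by exists (size t); rewrite nth_default.
  case: (ex_minnP ex) => k le_k_m min_k.
  have ge_m i : i < k -> m <= nth 0 t i.
    by move=> lt_i; case: leqP => // lt_m; have := min_k i (ltnW lt_m); lia.
  rewrite -(leq_add2l (k * m)) -(psum_eq_excess s_t ge_m le_k_m).
  exact: leq_trans (le_k k) (psum_le_excess s k m).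
rewrite (psum_eq_excess s_s (m := nth 0 s k)) //; last first.
  by move=> i lt_ik; apply: sorted_geq_nth => //; apply: ltnW.
by apply: leq_trans (psum_le_excess _ _ (nth 0 s k)) _; rewrite leq_add2l.
Qed.

Lemma partition_sorted (lam : Defs.partition) : sorted geq lam.
Proof. by case: lam => s /= /andP[]. Qed.

Lemma weightE (lam : Defs.partition) : weight lam = excess 0 lam.
Proof.
rewrite /weight /excess (big_nth 0) big_mkord.
by apply: eq_bigr => i _; rewrite subn0.
Qed.

Lemma nat_leP (lam mu : Defs.partition) :
  nat_le lam mu <-> excess 0 lam = excess 0 mu /\
                    forall m, excess m mu <= excess m lam.
Proof.
rewrite /nat_le !weightE.
by have H := excess_dom (partition_sorted lam) (partition_sorted mu); tauto.
Qed.

(** The entries are the [2m - eps] with [m] a part of [be] and [m - eps] the part of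
    [ga] of the same index. *)
Definition code (be ga : Defs.partition) : seq nat :=
  [seq part be i + part ga i | i <- iota 0 (size be)].

Definition interlaced (be ga : Defs.partition) : Prop :=
  forall i, part ga i <= part be i <= (part ga i).+1.

Lemma excessE (lam : Defs.partition) m n : size lam <= n ->
  excess m lam = \sum_(i <- iota 0 n) (part lam i - m).
Proof.
move=> le_n; rewrite -[n](subnKC le_n) iotaD big_cat /= add0n.
rewrite [X in _ = _ + X]big1_seq ?addn0; last first.
  by move=> i /andP[_]; rewrite mem_iota => /andP[hi _]; rewrite /part nth_default.
by rewrite /excess (big_nth 0) /index_iota subn0.
Qed.

Lemma size_interlaced be ga : interlaced be ga -> size ga <= size be.
Proof.
move=> il; rewrite leqNgt; apply/negP => lt_s.
have := il (size be); rewrite /part (nth_default _ (leqnn _)) leqn0.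
move=> /andP[/eqP h0 _]; move: (mem_nth 0 lt_s); rewrite h0.
by case: ga {il lt_s h0} => s /= /andP[_ /negPf->].
Qed.

Lemma tailsum_code_beta be ga m : interlaced be ga ->
  tailsum m.*2 (code be ga) = excess m be.
Proof.
move=> il; rewrite (excessE _ (leqnn _)) /tailsum /code big_map.
by apply: eq_bigr => i _; have := il i; lia.
Qed.

Lemma tailsum_code_gamma be ga m : interlaced be ga ->
  tailsum m.*2.+1 (code be ga) = excess m ga.
Proof.
move=> il; rewrite (excessE _ (size_interlaced il)) /tailsum /code big_map.
by apply: eq_bigr => i _; have := il i; lia.
Qed.

Lemma tailsum_code_dom beX gaX beY gaY :
    interlaced beX gaX -> interlaced beY gaY ->
  nat_le beX beY /\ nat_le gaX gaY <->
  [/\ forall n, tailsum n (code beY gaY) <= tailsum n (code beX gaX),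
      tailsum 0 (code beY gaY) = tailsum 0 (code beX gaX)
    & tailsum 1 (code beY gaY) = tailsum 1 (code beX gaX)].
Proof.
move=> ilX ilY; rewrite !nat_leP.
have eX m := tailsum_code_beta m ilX; have eY m := tailsum_code_beta m ilY.
have gX m := tailsum_code_gamma m ilX; have gY m := tailsum_code_gamma m ilY.
have := (eX 0, eY 0, gX 0, gY 0); rewrite double0 => -[[[-> ->] ->] ->].
split=> [[[e0 he] [g0 hg]]|[hn e0 g0]].
  split=> // n; rewrite -[n]odd_double_half; case: (odd n) => /=.
    by rewrite add1n gX gY.
  by rewrite add0n eX eY.
split; split=> // m; [by rewrite -eX -eY | by rewrite -gX -gY].
Qed.

Lemma nth_nzparts s i : sorted geq s -> nth 0 (nzparts s) i = nth 0 s i.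
Proof.
elim: s i => [|c s IHs] i s_s; first by [].
have s_s' := path_sorted s_s; rewrite /nzparts /=; case: eqP => [c0|_] /=.
  have z j : nth 0 (c :: s) j = 0.
    apply/eqP; rewrite -leqn0.
    by apply: leq_trans (sorted_geq_nth s_s (leq0n j)) _; rewrite /= c0.
  by rewrite z [LHS](IHs i s_s') -[RHS](z i.+1).
by case: i => [|i] //=; apply: IHs.
Qed.

(** Rounding the codes up and down commutes with sorting, as both roundings are
    monotone; a code 1 leaves no part in [ga]. *)
Lemma code_surj s : exists be ga : Defs.partition,
  interlaced be ga /\ perm_eq (code be ga) (nzparts s).
Proof.
have geq_trans : transitive geq by move=> ? ? ? /= h1 h2; apply: leq_trans h2 h1.
pose t := sort geq (nzparts s).
have s_t : sorted geq t by apply: sort_sorted => x y; apply: leq_total.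
have t_nz c : c \in t -> 0 < c by rewrite mem_sort mem_filter lt0n => /andP[].
have be_ok : sorted geq (map uphalf t) && (0 \notin map uphalf t).
  apply/andP; split.
    by apply: homo_sorted s_t => x y /= le_xy; apply: uphalf_leq.
  by apply/mapP => -[c /t_nz]; lia.
have s_g : sorted geq (map half t).
  by apply: homo_sorted s_t => x y /= le_xy; apply: half_leq.
have ga_ok : sorted geq (nzparts (map half t)) && (0 \notin nzparts (map half t)).
  by rewrite (sorted_filter geq_trans) // mem_filter.
have nth_map_t (f : nat -> nat) i : f 0 = 0 -> nth 0 (map f t) i = f (nth 0 t i).
  move=> f0; have [lt_i|le_i] := ltnP i (size t); first exact: nth_map.
  by rewrite !nth_default ?size_map.
exists (Partition be_ok), (Partition ga_ok).
have pb i : part (Partition be_ok) i = uphalf (nth 0 t i) by exact: nth_map_t.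
have pg i : part (Partition ga_ok) i = (nth 0 t i)./2.
  by rewrite /part nth_nzparts //; apply: nth_map_t.
split=> [i|]; first by rewrite pb pg; lia.
suff -> : code (Partition be_ok) (Partition ga_ok) = t by rewrite perm_sort.
rewrite /code size_map -[RHS](mkseq_nth 0); apply: eq_map => i.
by rewrite pb pg; lia.
Qed.

Local Open Scope ring_scope.

(** * Matrices and bases of column spaces *)
Section ColumnSpaces.
Variable K : fieldType.

Lemma dim_cV n : \dim {: 'cV[K]_n} = n.
Proof. by rewrite dimvf /dim /= muln1. Qed.

Lemma linear_cV_mx n m (F : {linear 'cV[K]_n -> 'cV[K]_m}) :
  exists M : 'M[K]_(m, n), forall v, F v = M *m v.
Proof.
exists (\matrix_(i, j) F (delta_mx j 0) i 0) => v.
rewrite {1}[v]matrix_sum_delta linear_sum; apply/matrixP => i k.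
rewrite (ord1 k) summxE mxE; apply: eq_bigr => j _.
by rewrite big_ord1 linearZ !mxE mulrC.
Qed.

Lemma free_mx n m (X : seq 'cV[K]_n) (Y : seq 'cV[K]_m) :
  free X -> size Y = size X -> exists M, [seq M *m x | x <- X] = Y.
Proof.
move=> fX sY; have [F /(_ fX sY) <-] := linear_of_free X Y.
have [M hM] := linear_cV_mx F.
by exists M; apply: eq_map => x; rewrite hM.
Qed.

Lemma eq_mx_basis n m (X : seq 'cV[K]_n) (A B : 'M[K]_(m, n)) :
  basis_of fullv X -> {in X, forall x, A *m x = B *m x} -> A = B.
Proof.
move=> bX eqX.
have eqv (v : 'cV_n) : A *m v = B *m v.
  have vX : v \in <<in_tuple X>>%VS by rewrite (span_basis bX) memvf.
  rewrite (coord_span vX).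
  rewrite !mulmx_sumr; apply: eq_bigr => i _.
  by rewrite -!scalemxAr eqX // mem_nth.
by apply/matrixP => i j; have /matrixP/(_ i 0) := eqv (delta_mx j 0); rewrite -!colE !mxE.
Qed.

Lemma basis_full_cV n (X : seq 'cV[K]_n) :
  size X = n -> (forall x, x \in <<X>>%VS) -> basis_of fullv X.
Proof.
move=> sX spX; rewrite basisEdim dim_cV sX leqnn andbT.
by apply/subvP => x _.
Qed.

Variables (n : nat) (phi : 'M[K]_n).
Local Notation it j := (iter j (mulmx phi)).

Lemma iter_mulmxD j u v : it j (u + v) = it j u + it j v :> 'cV_n.
Proof. by elim: j => //= j ->; rewrite mulmxDr. Qed.

Lemma iter_mulmxZ j t u : it j (t *: u) = t *: it j u :> 'cV_n.
Proof. by elim: j => //= j ->; rewrite scalemxAr. Qed.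

Lemma iter_mulmx0 j : it j 0 = 0 :> 'cV_n.
Proof. by elim: j => //= j ->; rewrite mulmx0. Qed.

Lemma iter_mulmxB j u v : it j (u - v) = it j u - it j v :> 'cV_n.
Proof. by rewrite iter_mulmxD -scaleN1r iter_mulmxZ scaleN1r. Qed.

Lemma iter_mulmxX j (v : 'cV_n) : it j v = phi ^+ j *m v.
Proof. by elim: j => [|j /= ->]; rewrite ?expr0 ?mul1mx // exprS mulmxA. Qed.

End ColumnSpaces.

(** * Chain bases of a point of the variety *)
Section ChainBases.
Variable K : fieldType.

(** A picket summand: its code [c], a vector generating it and, if [c] is odd, a
    vector of the subspace sent to the last vector of the chain.  For even [c] the
    last component is arbitrary. *)
Definition gen (a b : nat) : Type := (nat * ('cV[K]_b * 'cV[K]_a))%type.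

Definition chain_vecs a b (phi : 'M[K]_b) (L : seq (gen a b)) : seq 'cV[K]_b :=
  flatten [seq traject (mulmx phi) l.2.1 (uphalf l.1) | l <- L].

Definition sub_vecs a b (L : seq (gen a b)) : seq 'cV[K]_a :=
  [seq l.2.2 | l <- L & odd l.1].

(** A decomposition of the point [(f, phi)] into pickets: the chain of code [c] has
    [uphalf c] vectors, and the last one, of index [c./2] when [c] is odd, lies in
    the image of [f] exactly for odd codes. *)
Definition chain_basis a b (f : 'M[K]_(b, a)) (phi : 'M[K]_b)
    (L : seq (gen a b)) : Prop :=
  [/\ basis_of fullv (chain_vecs phi L), basis_of fullv (sub_vecs L),
      {in L, forall l, iter (uphalf l.1) (mulmx phi) l.2.1 = 0}
    & {in L, forall l, odd l.1 -> f *m l.2.2 = iter l.1./2 (mulmx phi) l.2.1}].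

Lemma flatten_map_inj (S T : eqType) (A B : S -> seq T) (M : seq S) :
    (forall x, size (A x) = size (B x)) ->
    flatten (map A M) = flatten (map B M) -> {in M, A =1 B}.
Proof.
move=> sAB; elim: M => //= x M IHM /eqP; rewrite eqseq_cat //.
by move=> /andP[/eqP eqx /eqP/IHM eqM] y; rewrite inE => /predU1P[->|/eqM].
Qed.

Lemma zip_gen a b a' b' (L : seq (gen a b)) (L' : seq (gen a' b')) :
    unzip1 L = unzip1 L' ->
  exists M : seq (nat * ('cV[K]_b * 'cV[K]_a) * ('cV[K]_b' * 'cV[K]_a')),
    L = unzip1 M /\ L' = [seq (m.1.1, m.2) | m <- M].
Proof.
elim: L L' => [|[c x] L IHL] [|[c' x'] L'] //=; first by exists [::].
by case=> <- /IHL[M [-> ->]]; exists (((c, x), x') :: M).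
Qed.

Lemma size_chain_vecs a b (phi : 'M[K]_b) (L : seq (gen a b)) :
  size (chain_vecs phi L) = (\sum_(c <- unzip1 L) uphalf c)%N.
Proof.
rewrite size_flatten /shape -map_comp sumnE !big_map.
by apply: eq_bigr => l _; rewrite /= size_traject.
Qed.

Lemma size_sub_vecs a b (L : seq (gen a b)) :
  size (sub_vecs L) = count odd (unzip1 L).
Proof. by rewrite size_map size_filter count_map. Qed.

Lemma mem_chain_vecs a b (phi : 'M[K]_b) (L : seq (gen a b)) l j :
  l \in L -> (j < uphalf l.1)%N -> iter j (mulmx phi) l.2.1 \in chain_vecs phi L.
Proof.
move=> lL lt_j; apply/flatten_mapP; exists l => //.
by apply/trajectP; exists j.
Qed.

Lemma chain_vecsP a b (phi : 'M[K]_b) (L : seq (gen a b)) x :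
  reflect (exists2 l, l \in L & exists2 j, (j < uphalf l.1)%N &
             x = iter j (mulmx phi) l.2.1) (x \in chain_vecs phi L).
Proof.
apply: (iffP flatten_mapP) => [[l lL /trajectP[j lt_j ->]]|].
  by exists l => //; exists j.
by case=> l lL [j lt_j ->]; exists l => //; apply/trajectP; exists j.
Qed.

(** The base change that sends one chain basis to the other one is a morphism,
    because beyond the end of a chain both sides are zero. *)
Lemma chain_hom a b a' b' (f : 'M[K]_(b, a)) phi L
    (f' : 'M[K]_(b', a')) phi' L' :
    chain_basis f phi L -> chain_basis f' phi' L' -> unzip1 L = unzip1 L' ->
  exists g h, [/\ h *m phi = phi' *m h, h *m f = f' *m g,
    [seq h *m x | x <- chain_vecs phi L] = chain_vecs phi' L' &
    [seq g *m x | x <- sub_vecs L] = sub_vecs L'].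
Proof.
move=> [bV bW zL fL] [_ _ zL' fL'] eqL.
have [h hP] := free_mx (Y := chain_vecs phi' L') (basis_free bV)
  ltac:(by rewrite !size_chain_vecs eqL).
have [g gP] := free_mx (Y := sub_vecs L') (basis_free bW)
  ltac:(by rewrite !size_sub_vecs eqL).
exists g, h.
have [M [eL eL']] := zip_gen eqL.
have hM : {in M, forall m j, h *m iter j (mulmx phi) m.1.2.1
                             = iter j (mulmx phi') m.2.1}.
  move=> m mM j.
  have [lt_j|le_j] := ltnP j (uphalf m.1.1).
    pose A (m' : nat * ('cV[K]_b * 'cV[K]_a) * ('cV[K]_b' * 'cV[K]_a')) :=
      [seq h *m x | x <- traject (mulmx phi) m'.1.2.1 (uphalf m'.1.1)].
    pose B (m' : nat * ('cV[K]_b * 'cV[K]_a) * ('cV[K]_b' * 'cV[K]_a')) :=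
      traject (mulmx phi') m'.2.1 (uphalf m'.1.1).
    have sz m' : size (A m') = size (B m') by rewrite /A size_map !size_traject.
    have eq_fl : flatten [seq A m' | m' <- M] = flatten [seq B m' | m' <- M].
      by move: hP; rewrite eL eL' /chain_vecs map_flatten -!map_comp.
    have eqm := flatten_map_inj sz eq_fl mM.
    rewrite -[RHS](nth_traject _ lt_j) -/(B m) -eqm (nth_map m.1.2.1) ?size_traject //.
    by rewrite nth_traject.
  have zero : iter (uphalf m.1.1) (mulmx phi) m.1.2.1 = 0.
    by apply: (zL m.1); rewrite eL map_f.
  have zero' : iter (uphalf m.1.1) (mulmx phi') m.2.1 = 0.
    by apply: (zL' (m.1.1, m.2)); rewrite eL' map_f.
  by rewrite -(subnK le_j) !iterD zero zero' !iter_mulmx0 mulmx0.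
have gM : {in M, forall m, odd m.1.1 -> g *m m.1.2.2 = m.2.2}.
  move=> m mM odd_m; move: gP; rewrite eL eL' /sub_vecs !filter_map -!map_comp.
  by move/eq_in_map; apply; rewrite mem_filter mM andbT.
split=> //.
  apply: (eq_mx_basis bV) => x /chain_vecsP[l]; rewrite eL => /mapP[m mM ->] [j _ ->].
  by rewrite -!mulmxA (hM m mM j) -!iterS (hM m mM j.+1).
apply: (eq_mx_basis bW) => x /mapP[l]; rewrite mem_filter => /andP[odd_l].
rewrite eL => /mapP[m mM el]; move: odd_l; rewrite el => odd_m -> {x l el}.
rewrite -!mulmxA (gM m mM odd_m) (fL m.1) ?eL ?map_f // hM //.
by rewrite (fL' (m.1.1, m.2)) // eL' map_f.
Qed.

Lemma chain_iso a b a' b' (f : 'M[K]_(b, a)) phi L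
    (f' : 'M[K]_(b', a')) phi' L' :
    chain_basis f phi L -> chain_basis f' phi' L' -> unzip1 L = unzip1 L' ->
  exists g h g' h', [/\ h *m phi = phi' *m h, h *m f = f' *m g,
    h' *m phi' = phi *m h', h' *m f' = f *m g'
  & [/\ h' *m h = 1%:M, h *m h' = 1%:M, g' *m g = 1%:M & g *m g' = 1%:M]].
Proof.
move=> cL cL' eqL.
have [g [h [hphi hf hV gW]]] := chain_hom cL cL' eqL.
have [g' [h' [hphi' hf' hV' gW']]] := chain_hom cL' cL (esym eqL).
have inv n m (X : seq 'cV[K]_n) (Y : seq 'cV[K]_m) A B :
    basis_of fullv X -> [seq A *m x | x <- X] = Y -> [seq B *m y | y <- Y] = X ->
    B *m A = 1%:M.
  move=> bX eY eX; apply: (eq_mx_basis bX) => x xX; rewrite mul1mx.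
  move: eX; rewrite -eY -map_comp -[RHS]map_id => /eq_in_map/(_ x xX) /=.
  by rewrite mulmxA.
case: cL cL' => bV bW _ _ [bV' bW' _ _].
exists g, h, g', h'; split=> //; split.
- exact: inv bV hV hV'.
- exact: inv bV' hV' hV.
- exact: inv bW gW gW'.
- exact: inv bW' gW' gW.
Qed.

Lemma chain_basis_perm a b (f : 'M[K]_(b, a)) phi L L' :
  perm_eq L L' -> chain_basis f phi L -> chain_basis f phi L'.
Proof.
move=> pL [bV bW zL fL]; split.
- by rewrite -(perm_basis _ (perm_flatten (perm_map _ pL))).
- by rewrite -(perm_basis _ (perm_map _ (perm_filter _ pL))).
- by move=> l; rewrite -(perm_mem pL) => /zL.
- by move=> l; rewrite -(perm_mem pL) => /fL.
Qed.

Lemma chain_basis_nz a b (f : 'M[K]_(b, a)) phi L :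
  chain_basis f phi L -> chain_basis f phi [seq l <- L | l.1 != 0%N].
Proof.
have eV : chain_vecs phi [seq l <- L | l.1 != 0%N] = chain_vecs phi L.
  rewrite /chain_vecs; elim: L => // [[[|c] x] L] IHL; first exact: IHL.
  by rewrite /= IHL.
have eW : sub_vecs [seq l <- L | l.1 != 0%N] = sub_vecs L.
  rewrite /sub_vecs; elim: L {eV} => // [[[|c] x] L] IHL; first exact: IHL.
  by rewrite /=; case: ifP => _; rewrite /= IHL.
move=> [bV bW zL fL]; split; rewrite ?eV ?eW //.
- by move=> l; rewrite mem_filter => /andP[_ /zL].
- by move=> l; rewrite mem_filter => /andP[_ /fL].
Qed.

(** Codes equal to zero stand for zero summands, hence the comparison up to
    [nzparts]. *)
Definition has_code a b (f : 'M[K]_(b, a)) (phi : 'M[K]_b) (s : seq nat) : Prop :=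
  exists2 L, chain_basis f phi L & perm_eq (nzparts (unzip1 L)) (nzparts s).

Lemma has_codeP a b (f : 'M[K]_(b, a)) phi s : has_code f phi s ->
  exists2 L, chain_basis f phi L & unzip1 L = nzparts s.
Proof.
case=> L cL; have := chain_basis_nz cL.
rewrite /nzparts /unzip1 filter_map.
move: [seq l <- L | _] => {cL}L cL eL.
have eL' : perm_eq (unzip1 L) [seq x <- s | x != 0%N] by exact: eL.
rewrite perm_sym in eL'; have [Is pIs ->] := perm_iotaP 0%N eL'.
rewrite size_map in pIs.
exists [seq nth (0%N, (0, 0)) L i | i <- Is].
  apply: chain_basis_perm cL; rewrite perm_sym.
  apply: perm_trans (perm_map _ pIs) _.
  by rewrite -[X in perm_eq _ X](mkseq_nth (0%N, (0, 0))).
rewrite /unzip1 -map_comp; apply/eq_in_map => i; rewrite (perm_mem pIs) mem_iota => hi.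
by rewrite /= (nth_map (0%N, (0, 0))).
Qed.

End ChainBases.

(** * Gluing two chains along a line of points *)
Section Gluing.
Variable K : fieldType.

Lemma mx_on_basis n m (X : seq 'cV[K]_n) (F : 'cV[K]_n -> 'cV[K]_m) :
  free X -> exists M, {in X, forall x, M *m x = F x}.
Proof.
move=> fX; have [M /eq_in_map hM] := free_mx (Y := map F X) fX (size_map _ _).
by exists M.
Qed.

Lemma size_basis_cV n (X : seq 'cV[K]_n) : basis_of fullv X -> size X = n.
Proof.
move=> bX; have := basis_free bX.
by rewrite /free (span_basis bX) dim_cV => /eqP.
Qed.

Lemma basis_change n (X Y : seq 'cV[K]_n) :
  basis_of fullv X -> size Y = size X -> {subset X <= <<Y>>%VS} ->
  basis_of fullv Y.
Proof.
move=> bX sY subXY; apply: basis_full_cV.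
  by rewrite sY (size_basis_cV bX).
move=> x; have: x \in <<X>>%VS by rewrite (span_basis bX) memvf.
by apply/subvP: x; apply/span_subvP.
Qed.

Variables (a b : nat) (f : 'M[K]_(b, a)) (phi : 'M[K]_b).
Variables (al e d : nat) (x u : 'cV[K]_b) (wx wu : 'cV[K]_a) (L : seq (gen K a b)).
Hypotheses (lt_al : (d < al)%N) (lt_e : (d < e)%N) (odd_d : odd d = odd e).
Hypothesis cL : chain_basis f phi [:: (al, (x, wx)), (e, (u, wu)) & L].

Local Ltac arith :=
  repeat match goal with
    | H : forall _, _ |- _ => clear H
    | H : chain_basis _ _ _ |- _ => clear H
    | H : is_true (basis_of _ _) |- _ => clear H
    | H : _ = _ :> 'M_(_, _) |- _ => clear H
  end; lia.

(** The direction [N] in which [phi] moves glues the end of the [u]-chain to the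
    vector of index [uphalf d] of the [x]-chain. *)
Lemma exists_glue_phi : exists N : 'M[K]_b,
  [/\ forall j, N *m iter j (mulmx phi) x = 0,
      forall j, (j.+1 < uphalf e)%N -> N *m iter j (mulmx phi) u = 0,
      N *m iter (uphalf e).-1 (mulmx phi) u = iter (uphalf d) (mulmx phi) x
    & {in L, forall l j, N *m iter j (mulmx phi) l.2.1 = 0}].
Proof.
case: cL => bV _ zL _.
pose lastu := iter (uphalf e).-1 (mulmx phi) u.
have [N hN] := mx_on_basis
  (fun y => if y == lastu then iter (uphalf d) (mulmx phi) x else 0) (basis_free bV).
have e_gt0 : (0 < uphalf e)%N by arith.
have uV := free_uniq (basis_free bV).
have lastV : lastu \in traject (mulmx phi) u (uphalf e).
  by apply/trajectP; exists (uphalf e).-1; rewrite ?prednK.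
have xV j : (j < uphalf al)%N -> iter j (mulmx phi) x \in traject (mulmx phi) x (uphalf al).
  by move=> lt_j; apply/trajectP; exists j.
rewrite /chain_vecs /= !cat_uniq in uV.
case/and3P: uV => _ /hasPn xu /and3P[uu /hasPn uL _].
have memL : {subset L <= [:: (al, (x, wx)), (e, (u, wu)) & L]}.
  by move=> l lL; rewrite !inE lL !orbT.
exists N; split.
- move=> j; have [lt_j|le_j] := ltnP j (uphalf al); last first.
    by rewrite -(subnK le_j) iterD (zL (al, (x, wx))) ?mem_head // iter_mulmx0 mulmx0.
  rewrite hN; last by rewrite /chain_vecs /= mem_cat xV.
  case: eqP => // ej; have := xV j lt_j; rewrite ej.
  by have /= := xu lastu; rewrite mem_cat lastV => /(_ isT)/negPf->.
- move=> j lt_j.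
  have juV : iter j (mulmx phi) u \in traject (mulmx phi) u (uphalf e).
    by apply/trajectP; exists j => //; apply: ltnW.
  rewrite hN; last by rewrite /chain_vecs /= !mem_cat juV orbT.
  case: eqP => // /eqP; rewrite -(nth_traject (mulmx phi) (ltnW lt_j) u).
  rewrite /lastu -(nth_traject (mulmx phi) (n := uphalf e)) ?prednK //.
  rewrite nth_uniq ?size_traject ?prednK // => [/eqP|]; arith.
- rewrite hN ?eqxx // -/lastu.
  by rewrite /chain_vecs /= !mem_cat lastV orbT.
- move=> l lL j; have [lt_j|le_j] := ltnP j (uphalf l.1); last first.
    by rewrite -(subnK le_j) iterD (zL l) ?memL // iter_mulmx0 mulmx0.
  have lV := mem_chain_vecs phi lL lt_j.
  rewrite hN; last by rewrite /chain_vecs /= !mem_cat [X in _ || (_ || X)]lV !orbT.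
  case: eqP => // ej; rewrite ej in lV.
  by have /= := uL lastu lV; rewrite lastV.
Qed.

(** For odd codes the end of the [u]-chain lies in the subspace; [G] corrects it by
    the vector of index [d./2] of the [x]-chain, so that the moved [phi] still
    kills it. *)
Lemma exists_glue_f : exists G : 'M[K]_(b, a),
  [/\ odd al -> G *m wx = 0,
      odd e -> G *m wu = - iter d./2 (mulmx phi) x
    & {in L, forall l, odd l.1 -> G *m l.2.2 = 0}].
Proof.
case: cL => _ bW _ _.
have [odd_e|even_e] := boolP (odd e); last first.
  by exists 0; split=> // [_|l _ _]; rewrite mul0mx.
have [G hG] := mx_on_basis
  (fun y => if y == wu then - iter d./2 (mulmx phi) x else 0) (basis_free bW).
have uW := free_uniq (basis_free bW).
have memL l : l \in L -> odd l.1 -> l.2.2 \in sub_vecs L.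
  by move=> lL ol; apply/mapP; exists l; rewrite // mem_filter ol.
move: uW hG; rewrite /sub_vecs /= odd_e.
case: (odd al) => /= [/andP[] | /andP[]].
  rewrite inE negb_or => /andP[wxu _] /andP[wuL _] hG.
  exists G; split=> // [_|_|l lL ol].
  - by rewrite hG ?mem_head // (negPf wxu).
  - by rewrite hG ?inE ?eqxx ?orbT.
  - rewrite hG ?inE ?(memL l) ?orbT //; case: eqP => // el.
    by case/negP: wuL; rewrite -el memL.
move=> wuL _ hG; exists G; split=> // [_|l lL ol].
- by rewrite hG ?inE ?eqxx ?orbT.
- rewrite hG ?inE ?(memL l) ?orbT //; case: eqP => // el.
  by case/negP: wuL; rewrite -el memL.
Qed.

(** At [t = 0] the chains of [x] and [u] are independent.  For [t != 0] the chain
    of [u] continues into the one of [x] and gets the code [al + e - d], while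
    [t x - phi^((e - d)/2) u] generates a chain of code [d]: the point is a
    nonsplit extension of the [u]-chain by the [x]-chain. *)
Lemma degen_family : exists (G : 'M[K]_(b, a)) (N : 'M[K]_b),
  forall t, t != 0 ->
  chain_basis (f + t *: G) (phi + t *: N)
    [:: ((al + e - d)%N, (u, t *: wx)),
        (d, (t *: x - iter ((e - d)./2) (mulmx (phi + t *: N)) u, - wu)) & L].
Proof.
have [N [Nx Nu Nlast NL]] := exists_glue_phi.
have [G [Gx Gu GL]] := exists_glue_f.
exists G, N => t t_nz; case: cL => bV bW zL fL.
set psi := phi + t *: N; set g := f + t *: G; set v := t *: x - _; set L' := [:: _, _ & L].
have memL l : l \in L -> l \in [:: (al, (x, wx)), (e, (u, wu)) & L].
  by move=> lL; rewrite !inE lL !orbT.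
have memx : (al, (x, wx)) \in [:: (al, (x, wx)), (e, (u, wu)) & L] by apply: mem_head.
have memu : (e, (u, wu)) \in [:: (al, (x, wx)), (e, (u, wu)) & L].
  by rewrite inE mem_head orbT.
have psiE y : psi *m y = phi *m y + t *: (N *m y) by rewrite mulmxDl scalemxAl.
have gE y : g *m y = f *m y + t *: (G *m y) by rewrite mulmxDl scalemxAl.
have itx j : iter j (mulmx psi) x = iter j (mulmx phi) x.
  by elim: j => //= j ->; rewrite psiE Nx scaler0 addr0.
have itL l j : l \in L -> iter j (mulmx psi) l.2.1 = iter j (mulmx phi) l.2.1.
  by move=> lL; elim: j => //= j ->; rewrite psiE NL // scaler0 addr0.
have itu j : (j < uphalf e)%N -> iter j (mulmx psi) u = iter j (mulmx phi) u.
  elim: j => //= j IHj lt_j; rewrite IHj 1?ltnW // psiE Nu //.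
  by rewrite scaler0 addr0.
have itu' j : iter (j + uphalf e) (mulmx psi) u = t *: iter (j + uphalf d) (mulmx phi) x.
  elim: j => [|j IHj]; last first.
    by rewrite !addSn !iterS IHj psiE -!scalemxAr Nx !scaler0 addr0.
  rewrite !add0n; have -> : uphalf e = (uphalf e).-1.+1 by arith.
  rewrite iterS itu ?psiE ?Nlast; last by arith.
  by rewrite -iterS prednK ?(zL _ memu) ?add0r //; arith.
have ed : (uphalf d + (e - d)./2 = uphalf e)%N by arith.
have itv j : iter j (mulmx psi) v =
    t *: iter j (mulmx phi) x - iter (j + (e - d)./2) (mulmx psi) u.
  by rewrite iter_mulmxB iter_mulmxZ itx iterD.
have memL' l : l \in L -> l \in L' by move=> lL; rewrite !inE lL !orbT.
split.
- apply: basis_change bV _ _.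
    rewrite !size_chain_vecs /= !big_cons; arith.
  have spu j : (j < uphalf (al + e - d))%N -> iter j (mulmx psi) u \in <<chain_vecs psi L'>>%VS.
    move=> lt_j; apply: memv_span.
    by apply: (mem_chain_vecs psi (l := ((al + e - d)%N, (u, t *: wx)))) lt_j; apply: mem_head.
  have spv j : (j < uphalf d)%N -> iter j (mulmx psi) v \in <<chain_vecs psi L'>>%VS.
    move=> lt_j; apply: memv_span.
    by apply: (mem_chain_vecs psi (l := (d, (v, - wu)))) lt_j; rewrite inE mem_head orbT.
  move=> y /chain_vecsP[l + [j]]; rewrite !inE => /or3P[/eqP->|/eqP->|lL] /= lt_j ->.
  + rewrite -[iter j _ _]scale1r -(mulVf t_nz) -scalerA memvZ //.
    have [lt_jd|le_dj] := ltnP j (uphalf d).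
      rewrite -[t *: _](subrK (iter (j + (e - d)./2) (mulmx psi) u)) -itv.
      by rewrite memvD ?spv ?spu //; arith.
    rewrite -(subnK le_dj) -itu' spu //; arith.
  + by rewrite -itu // spu //; arith.
  + rewrite -(itL l j lL); apply: memv_span.
    exact: (mem_chain_vecs psi (memL' l lL) lt_j).
- apply: basis_change bW _ _.
    rewrite !size_sub_vecs /=; arith.
  move=> y /mapP[l]; rewrite mem_filter !inE => /andP[ol].
  have spL l' : l' \in L' -> odd l'.1 -> l'.2.2 \in <<sub_vecs L'>>%VS.
    by move=> lL' ol'; apply/memv_span/mapP; exists l'; rewrite // mem_filter ol'.
  case/or3P=> [/eqP el|/eqP el|lL] ->.
  + rewrite el /= in ol *; rewrite -[wx]scale1r -(mulVf t_nz) -scalerA memvZ //.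
    by apply: (spL ((al + e - d)%N, (u, t *: wx))); [apply: mem_head | rewrite /=; arith].
  + rewrite el /= in ol *; rewrite -memvN.
    by apply: (spL (d, (v, - wu))); [rewrite inE mem_head orbT | rewrite /=; arith].
  + exact: (spL l (memL' l lL) ol).
- move=> l; rewrite !inE => /or3P[/eqP->|/eqP->|lL] /=.
  + have -> : uphalf (al + e - d) = (uphalf al - uphalf d + uphalf e)%N by arith.
    rewrite itu' subnK; last by arith.
    by rewrite (zL _ memx) scaler0.
  + by rewrite itv ed -[X in iter X _ u]add0n itu' add0n subrr.
  + by rewrite itL // zL // memL.
- move=> l; rewrite !inE => /or3P[/eqP->|/eqP->|lL] /= ol.
  + have oal : odd al by arith.
    rewrite gE -!scalemxAr Gx // !scaler0 addr0 (fL _ memx) //=.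
    have -> : (al + e - d)./2 = (al./2 - uphalf d + uphalf e)%N by arith.
    by rewrite itu' subnK //; arith.
  + have oe : odd e by rewrite -odd_d.
    rewrite gE !mulmxN Gu // (fL _ memu) //= itv opprK.
    have -> : (d./2 + (e - d)./2 = e./2)%N by arith.
    by rewrite itu ?opprD ?opprK ?scalerN; [rewrite ?opprK addrC | arith].
  + by rewrite gE GL ?scaler0 ?addr0 ?itL ?fL // memL.
Qed.

End Gluing.

(** * Transport along isomorphisms, and direct sums of pickets *)
Section Transport.
Variable K : fieldType.

Lemma mulmx_span n m (M : 'M[K]_(m, n)) (X : seq 'cV[K]_n) (Y : seq 'cV[K]_m) x :
  x \in <<X>>%VS -> {in X, forall y, M *m y \in <<Y>>%VS} -> M *m x \in <<Y>>%VS.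
Proof.
move=> xX subM; have xX' : x \in <<in_tuple X>>%VS by [].
rewrite (coord_span xX') mulmx_sumr memv_suml // => i _.
by rewrite -scalemxAr memvZ // subM // mem_nth.
Qed.

Lemma iter_intertwine n m (h : 'M[K]_(m, n)) phi phi' j v :
  h *m phi = phi' *m h ->
  iter j (mulmx phi') (h *m v) = h *m iter j (mulmx phi) v :> 'cV_m.
Proof. by move=> hphi; elim: j => //= j ->; rewrite !mulmxA hphi. Qed.

Definition gen_map a b a' b' (g : 'M[K]_(a', a)) (h : 'M[K]_(b', b))
  (l : gen K a b) : gen K a' b' := (l.1, (h *m l.2.1, g *m l.2.2)).

Lemma unzip1_gen_map a b a' b' (g : 'M[K]_(a', a)) (h : 'M[K]_(b', b)) L :
  unzip1 [seq gen_map g h l | l <- L] = unzip1 L.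
Proof. by rewrite /unzip1 -map_comp. Qed.

Lemma chain_basis_transport a b a' b' (f : 'M[K]_(b, a)) phi
    (f' : 'M[K]_(b', a')) phi' g h g' h' L :
    h *m phi = phi' *m h -> h *m f = f' *m g ->
    h *m h' = 1%:M -> h' *m h = 1%:M -> g *m g' = 1%:M -> g' *m g = 1%:M ->
  chain_basis f phi L -> chain_basis f' phi' [seq gen_map g h l | l <- L].
Proof.
move=> hphi hf hh' h'h gg' g'g [bV bW zL fL].
have eqb : b' = b by apply/eqP; rewrite eqn_leq (mulmx1_min hh') (mulmx1_min h'h).
have eqa : a' = a by apply/eqP; rewrite eqn_leq (mulmx1_min gg') (mulmx1_min g'g).
split.
- apply: basis_full_cV.
    by rewrite size_chain_vecs unzip1_gen_map -(size_chain_vecs phi) (size_basis_cV bV) eqb.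
  move=> x; rewrite -[x]mul1mx -hh' -mulmxA.
  apply: (mulmx_span (X := chain_vecs phi L)); first by rewrite (span_basis bV) memvf.
  move=> y /chain_vecsP[l lL [j lt_j ->]]; rewrite -(iter_intertwine _ _ hphi).
  by apply/memv_span/(mem_chain_vecs phi' (l := gen_map g h l)); rewrite ?map_f.
- apply: basis_full_cV.
    by rewrite size_sub_vecs unzip1_gen_map -size_sub_vecs (size_basis_cV bW) eqa.
  move=> x; rewrite -[x]mul1mx -gg' -mulmxA.
  apply: (mulmx_span (X := sub_vecs L)); first by rewrite (span_basis bW) memvf.
  move=> y /mapP[l]; rewrite mem_filter => /andP[ol lL] ->.
  apply/memv_span/mapP; exists (gen_map g h l) => //.
  by rewrite mem_filter /= ol map_f.
- move=> l /mapP[m mL ->] /=.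
  by rewrite (iter_intertwine _ _ hphi) (zL m) // mulmx0.
- move=> l /mapP[m mL ->] /= ol.
  by rewrite (iter_intertwine _ _ hphi) -(fL m) // !mulmxA hf.
Qed.

Lemma has_code_transport a b a' b' (f : 'M[K]_(b, a)) phi
    (f' : 'M[K]_(b', a')) phi' g h g' h' s :
    h *m phi = phi' *m h -> h *m f = f' *m g ->
    h *m h' = 1%:M -> h' *m h = 1%:M -> g *m g' = 1%:M -> g' *m g = 1%:M ->
  has_code f phi s -> has_code f' phi' s.
Proof.
move=> hphi hf hh' h'h gg' g'g [L cL eL].
exists [seq gen_map g h l | l <- L]; last by rewrite unzip1_gen_map.
exact: (chain_basis_transport hphi hf hh' h'h gg' g'g).
Qed.

Section BlockInclusion.
Variables (n : nat) (p : 'I_n -> nat).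

Definition block_inc (i : 'I_n) : 'M[K]_(\sum_k p k, p i) := submxrow 1%:M i.

Lemma sum_block_inc m (v : 'M[K]_(\sum_k p k, m)) :
  \sum_i block_inc i *m submxcol v i = v.
Proof. by rewrite -mul_mxrow_mxcol submxrowK submxcolK mul1mx. Qed.

Lemma submxcol_block_inc i k :
  submxcol (block_inc i) k = if k == i then conform_mx 0 (1%:M : 'M_(p k)) else 0.
Proof. by rewrite /block_inc -mxdiagZ /mxdiag submxrow_matrix mxcolK. Qed.

End BlockInclusion.

Lemma block_inc_diag n (p q : 'I_n -> nat) (M : forall i, 'M[K]_(q i, p i)) i :
  (\mxblock_(k, j) (if k == j then conform_mx 0 (M k) else 0)
     : 'M_(\sum_k q k, \sum_k p k)) *m block_inc p i = block_inc q i *m M i.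
Proof.
rewrite /block_inc mul_submxrow mulmx1 submxrow_matrix.
apply/mxcolP => k; rewrite mxcolK -submxcol_mul -/(block_inc q i).
rewrite submxcol_block_inc; case: eqVneq => [->|_]; last by rewrite mul0mx.
by rewrite !conform_mx_id mul1mx.
Qed.

Lemma chain_basis_dsum n (X : 'I_n -> triple K)
    (L : forall i, seq (gen K (dim1 (X i)) (dim2 (X i)))) :
    (forall i, chain_basis (emb (X i)) (T2 (X i)) (L i)) ->
  chain_basis (emb (dsum X)) (T2 (dsum X))
    (flatten [seq [seq gen_map (block_inc (fun i => dim1 (X i)) i)
                               (block_inc (fun i => dim2 (X i)) i) l | l <- L i]
             | i <- enum 'I_n]).
Proof.
move=> cL; set J1 := block_inc _; set J2 := block_inc _; set LL := flatten _.
have T2J i : J2 i *m T2 (X i) = T2 (dsum X) *m J2 i by rewrite /= block_inc_diag.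
have embJ i : J2 i *m emb (X i) = emb (dsum X) *m J1 i by rewrite /= block_inc_diag.
have memLL i l : l \in L i -> gen_map (J1 i) (J2 i) l \in LL.
  by move=> lL; apply/flatten_mapP; exists i; rewrite ?mem_enum // map_f.
have unzipLL : unzip1 LL = flatten [seq unzip1 (L i) | i <- enum 'I_n].
  rewrite /unzip1 map_flatten -map_comp; congr flatten; apply: eq_map => i /=.
  exact: unzip1_gen_map.
split.
- apply: basis_full_cV.
    rewrite size_chain_vecs unzipLL big_flatten big_map big_enum /=.
    apply: eq_bigr => i _; case: (cL i) => bV _ _ _.
    by rewrite -(size_chain_vecs (T2 (X i))) (size_basis_cV bV).
  move=> x; rewrite -[x]sum_block_inc memv_suml // => i _; case: (cL i) => bV _ _ _.
  apply: (mulmx_span (X := chain_vecs (T2 (X i)) (L i))); first by rewrite (span_basis bV) memvf.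
  move=> y /chain_vecsP[l lL [j lt_j ->]]; rewrite -(iter_intertwine _ _ (T2J i)).
  by apply/memv_span/(mem_chain_vecs _ (memLL i l lL)).
- apply: basis_full_cV.
    rewrite size_sub_vecs unzipLL count_flatten sumnE 2!big_map big_enum /=.
    by apply: eq_bigr => i _; case: (cL i) => _ bW _ _; rewrite -size_sub_vecs (size_basis_cV bW).
  move=> x; rewrite -[x]sum_block_inc memv_suml // => i _; case: (cL i) => _ bW _ _.
  apply: (mulmx_span (X := sub_vecs (L i))); first by rewrite (span_basis bW) memvf.
  move=> y /mapP[l]; rewrite mem_filter => /andP[ol lL] ->.
  apply/memv_span/mapP; exists (gen_map (J1 i) (J2 i) l) => //.
  by rewrite mem_filter /= ol memLL.
- move=> m /flatten_mapP[i _ /mapP[l lL ->]] /=; case: (cL i) => _ _ zL _.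
  by rewrite (iter_intertwine _ _ (T2J i)) (zL l) // mulmx0.
- move=> m /flatten_mapP[i _ /mapP[l lL ->]] /= ol; case: (cL i) => _ _ _ fL.
  by rewrite (iter_intertwine _ _ (T2J i)) -(fL l) // !mulmxA -embJ.
Qed.

Lemma iter_cyclicT m j :
  iter j (mulmx (cyclicT K m)) (\col_i (i == 0%N :> nat)%:R)
  = \col_i (i == j :> nat)%:R.
Proof.
elim: j => //= j ->; apply/matrixP => r c; rewrite !mxE.
have [r0|r_gt0] := posnP r.
  by rewrite big1 ?r0 // => k _; rewrite !mxE r0 mul0r.
have lt_r : (r.-1 < m)%N by apply: leq_ltn_trans (leq_pred _) (ltn_ord r).
rewrite (bigD1 (Ordinal lt_r)) //= !mxE /= prednK // eqxx mul1r big1 ?addr0.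
  by rewrite -[in RHS](prednK r_gt0) eqSS.
move=> k; rewrite -val_eqE /= => ne; rewrite !mxE.
by rewrite -(prednK r_gt0) eqSS eq_sym (negPf ne) mul0r.
Qed.

Lemma chain_basis_picket eps m : (eps <= 1)%N -> (eps <= m)%N ->
  chain_basis (emb (picket K eps m)) (T2 (picket K eps m))
    [:: ((m.*2 - eps)%N, (\col_i (i == 0%N :> nat)%:R, const_mx 1))].
Proof.
move=> le_eps1 le_epsm.
have um : uphalf (m.*2 - eps) = m by lia.
have om : odd (m.*2 - eps) = (eps == 1)%N by lia.
split.
- apply: basis_full_cV; first by rewrite size_chain_vecs /= big_cons big_nil um addn0.
  move=> x; rewrite [x]matrix_sum_delta memv_suml // => i _.
  rewrite big_ord1 memvZ //; apply: memv_span; apply/chain_vecsP.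
  eexists; first exact: mem_head.
  exists i; first by rewrite /= um.
  rewrite /= iter_cyclicT; apply/matrixP => r c; rewrite !mxE.
  by rewrite ord1 andbT.
- apply: basis_full_cV; first by rewrite size_sub_vecs /= om; case: eqP; lia.
  move=> x; rewrite /sub_vecs /= om; case: eqP => [e1|ne1].
    move: x; rewrite e1 => x; rewrite /= span_seq1; apply/vlineP; exists (x 0 0).
    by apply/matrixP => i j; rewrite !mxE mulr1 !ord1.
  have e0 : eps = 0%N by lia.
  by move: x; rewrite e0 => x; rewrite flatmx0 mem0v.
- move=> l; rewrite inE => /eqP->; rewrite /= um iter_cyclicT.
  by apply/matrixP => i j; rewrite !mxE ltn_eqF.
- move=> l; rewrite inE => /eqP->; rewrite /= om => /eqP e1.
  have -> : (m.*2 - eps)./2 = m.-1 by lia.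
  rewrite iter_cyclicT; apply/matrixP => i j; rewrite !mxE.
  rewrite (eq_bigr (fun=> (i == m.-1 :> nat)%:R)); last first.
    by move=> k _; rewrite !mxE mulr1; congr (_%:R); lia.
  by rewrite big_const_ord e1 /= addr0.
Qed.

Lemma has_code_dsum_picket n (eps m : 'I_n -> nat) :
    (forall i, eps i <= 1)%N -> (forall i, eps i <= m i)%N ->
  has_code (emb (dsum (fun i => picket K (eps i) (m i))))
           (T2 (dsum (fun i => picket K (eps i) (m i))))
           [seq ((m i).*2 - eps i)%N | i <- enum 'I_n].
Proof.
move=> le1 lem; have cb i := chain_basis_picket (le1 i) (lem i).
have := @chain_basis_dsum n (fun i => picket K (eps i) (m i)) _ cb.
move=> cL; eexists; first exact: cL.
rewrite /unzip1 map_flatten -map_comp /=.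
by rewrite flatten_map1.
Qed.

Lemma has_code_exists a b s :
    (\sum_(c <- s) uphalf c)%N = b -> count odd s = a ->
  exists (f : 'M[K]_(b, a)) (phi : 'M[K]_b), has_code f phi s.
Proof.
move=> sb sa.
pose eps (i : 'I_(size s)) : nat := odd (nth 0%N s i).
pose m (i : 'I_(size s)) := uphalf (nth 0%N s i).
have e_s : [seq ((m i).*2 - eps i)%N | i <- enum 'I_(size s)] = s.
  rewrite -[RHS](mkseq_nth 0%N) /mkseq -val_enum_ord -map_comp.
  by apply: eq_map => i; rewrite /m /eps /=; lia.
have eb : (\sum_i m i)%N = b by rewrite -sb (big_nth 0%N) big_mkord.
have ea : (\sum_i eps i)%N = a.
  rewrite -sa -sum1_count (big_nth 0%N) big_mkord [RHS]big_mkcond.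
  by apply: eq_bigr => i _; rewrite /eps; case: odd.
have := @has_code_dsum_picket _ eps m; rewrite e_s.
pose D := dsum (fun i => picket K (eps i) (m i)); rewrite -/D.
have {ea} : dim1 D = a by []; have {eb} : dim2 D = b by [].
case: D => d1 d2 t1 t2 f /= <- <- hc; exists f, t2; apply: hc => i; rewrite /eps /m; lia.
Qed.

End Transport.

(** * Orbits are classified by codes *)
Section Variety.
Variables (K : fieldType) (a b : nat).

Lemma subseq_sub_vecs (f : 'M[K]_(b, a)) phi (L : seq (gen K a b)) :
    {in L, forall l, odd l.1 -> f *m l.2.2 = iter l.1./2 (mulmx phi) l.2.1} ->
  subseq [seq f *m w | w <- sub_vecs L] (chain_vecs phi L).
Proof.
elim: L => // l L IHL fL.
have {IHL} IHL : subseq [seq f *m w | w <- sub_vecs L] (chain_vecs phi L).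
  by apply: IHL => m mL; apply: fL; rewrite inE mL orbT.
have := fL l (mem_head _ _); rewrite /sub_vecs /chain_vecs /= => fl.
case: ifP => ol; last exact: subseq_trans IHL (suffix_subseq _ _).
rewrite /= fl // -cat1s cat_subseq // sub1seq.
by apply/trajectP; exists l.1./2 => //; lia.
Qed.

Lemma subseq_free (X Y : seq 'cV[K]_b) : subseq X Y -> free Y -> free X.
Proof.
move=> /perm_to_subseq[Z pY]; rewrite (perm_free pY); exact: catl_free.
Qed.

Lemma chain_basis_variety (f : 'M[K]_(b, a)) phi L :
  chain_basis f phi L -> variety (f, phi).
Proof.
move=> cL; case: (cL) => bV bW zL fL; split=> /=.
- apply: (eq_mx_basis bV) => x /chain_vecsP[l lL [j lt_j ->]].
  rewrite mul0mx -iter_mulmxX -iterD.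
  have le_b : (uphalf l.1 <= b)%N.
    apply: leq_trans (eq_leq (size_basis_cV bV)).
    by rewrite size_chain_vecs big_map (perm_big _ (perm_to_rem lL)) big_cons leq_addr.
  by rewrite -(subnK (leq_trans le_b (leq_addr j b))) iterD zL ?iter_mulmx0.
- apply: (eq_mx_basis bW) => x /mapP[l]; rewrite mem_filter => /andP[ol lL] ->.
  rewrite mul0mx -mulmxA fL // -iterS.
  have -> : (l.1./2.+1 = uphalf l.1)%N by move: ol; clear; lia.
  exact: zL.
- have [M eM] := free_mx (subseq_free (subseq_sub_vecs fL) (basis_free bV)) (esym (size_map _ _)).
  have Mf : M *m f = 1%:M.
    apply: (eq_mx_basis bW) => w wW; rewrite mul1mx -mulmxA.
    by move: eM; rewrite -map_comp -[RHS]map_id => /eq_in_map/(_ w wW).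
  have le_a : (a <= \rank f)%N.
    by apply: (@mulmx1_min_rank _ _ _ _ f M 1%:M); rewrite mulmx1.
  have := rank_leq_row f; have := rank_leq_col f; move: (\rank f) le_a; clear; lia.
Qed.

Lemma chain_basis_orbit (f f' : 'M[K]_(b, a)) phi phi' L L' :
    chain_basis f phi L -> chain_basis f' phi' L' -> unzip1 L = unzip1 L' ->
  GL_orbit (f, phi) (f', phi').
Proof.
move=> cL cL' eqL; have [g [h [g' [h' [hphi hf _ _ [h'h hh' g'g gg']]]]]] := chain_iso cL cL' eqL.
have [ug _] := mulmx1_unit gg'; have [uh _] := mulmx1_unit hh'.
exists g, h; split=> //; rewrite /GL_act /= hphi hf.
by rewrite -!mulmxA !mulmxV // !mulmx1.
Qed.

Lemma has_code_orbit (p q : 'M[K]_(b, a) * 'M[K]_b) s :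
  has_code p.1 p.2 s -> GL_orbit p q -> has_code q.1 q.2 s.
Proof.
move=> hp [g [h [ug uh ->]]]; move: hp; rewrite /GL_act /=.
apply: (has_code_transport (g := g) (h := h) (g' := invmx g) (h' := invmx h));
  by rewrite ?mulmxV ?mulVmx // -!mulmxA mulVmx ?mulmx1.
Qed.

Lemma orbit_has_code (p q : 'M[K]_(b, a) * 'M[K]_b) s s' :
  has_code p.1 p.2 s -> has_code q.1 q.2 s' -> perm_eq (nzparts s) (nzparts s') ->
  GL_orbit p q.
Proof.
case: p q => f phi [f' phi'] /= [L0 cL0 pL0] hq eqs.
have [L cL eL] : exists2 L, chain_basis f phi L & unzip1 L = nzparts s'.
  by apply: has_codeP; exists L0 => //; apply: perm_trans eqs.
have [L' cL' eL'] := has_codeP hq.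
by apply: (chain_basis_orbit cL cL'); rewrite eL eL'.
Qed.

Lemma has_code_variety (p : 'M[K]_(b, a) * 'M[K]_b) s :
  has_code p.1 p.2 s -> variety p.
Proof. by case: p => f phi [L /chain_basis_variety]. Qed.

End Variety.

Section CodeDims.
Variables (K : fieldType) (a b : nat).

Lemma tailsum0 s : tailsum 0 s = (\sum_(c <- s) uphalf c)%N.
Proof. by apply: eq_bigr => c _; lia. Qed.

Lemma tailsum1 s : (tailsum 1 s + count odd s = tailsum 0 s)%N.
Proof.
elim: s => [|c s IHs]; first by rewrite /tailsum !big_nil.
rewrite !tailsum_cons /= -IHs; move: (tailsum 1 s) (count odd s); clear; lia.
Qed.

Lemma has_code_dims (f : 'M[K]_(b, a)) phi s :
  has_code f phi s -> tailsum 0 s = b /\ (tailsum 1 s + a)%N = b.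
Proof.
move=> /has_codeP[L [bV bW _ _] eL].
have sV := size_basis_cV bV; have sW := size_basis_cV bW.
rewrite size_chain_vecs -tailsum0 eL tailsum_nzparts in sV.
rewrite size_sub_vecs eL in sW; split=> //.
rewrite -(tailsum_nzparts 1) -[in RHS]sV -(tailsum_nzparts 0) -tailsum1; lia.
Qed.

Lemma code_exists s : tailsum 0 s = b -> (tailsum 1 s + a)%N = b ->
  exists (f : 'M[K]_(b, a)) (phi : 'M[K]_b), has_code f phi s.
Proof.
move=> e0 e1; apply: has_code_exists; first by rewrite -tailsum0.
have := tailsum1 s; lia.
Qed.

End CodeDims.

(** * Dominance implies degeneration *)
Section Closure.
Variables (K : closedFieldType) (a b : nat).
Local Notation space := ('M[K]_(b, a) * 'M[K]_b)%type.

(** Otherwise [1 + X g] would be nonconstant, and [g] would not vanish at any of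
    its roots, which are nonzero. *)
Lemma poly_zero_off (g : {poly K}) :
  (forall t, t != 0 -> g.[t] = 0) -> g.[0] = 0.
Proof.
move=> g0; apply/eqP/negPn/negP => ng.
have g_nz : g != 0 by apply: contraNneq ng => ->; rewrite horner0.
have := closed_rootP (1 + 'X * g).
have sz : size (1 + 'X * g) != 1%N.
  have sXg : size ('X * g) = (size g).+1 by rewrite mulrC size_mulX.
  by rewrite addrC size_polyDl sXg ?size_poly1 ?eqSS ?size_poly_eq0 // ltnS size_poly_gt0.
rewrite sz => /elimT -/(_ isT)[t]; rewrite rootE !hornerE => /eqP ht.
have t_nz : t != 0 by apply: contra_eqN ht => /eqP->; rewrite mul0r addr0 oner_eq0.
by move: ht; rewrite g0 // mulr0 addr0 => /eqP; rewrite oner_eq0.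
Qed.

Lemma meval_line n (P : {mpoly K[n]}) (u v : 'I_n -> K) :
  exists g : {poly K}, forall t, P.@[fun i => u i + t * v i] = g.[t].
Proof.
exists (\sum_(m <- msupp P) P@_m *: \prod_(i < n) ((u i)%:P + v i *: 'X) ^+ m i) => t.
rewrite mevalE horner_sum; apply: eq_bigr => m _.
rewrite hornerZ horner_prod; congr (_ * _); apply: eq_bigr => i _.
by rewrite !hornerE [t * _]mulrC.
Qed.

Lemma coords_line (p q : space) t i :
  coords (p.1 + t *: q.1, p.2 + t *: q.2) i = coords p i + t * coords q i.
Proof.
rewrite /coords /= !linearD !linearZ /= -[in LHS]add_row_mx -scale_row_mx.
by rewrite !mxE.
Qed.

Lemma closure_line (A : space -> Prop) (p q : space) :
    variety p -> (forall t, t != 0 -> A (p.1 + t *: q.1, p.2 + t *: q.2)) ->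
  zariski_closure A p.
Proof.
move=> vp hA; split=> // C [I hI] AC; apply/hI; split=> // P IP.
have [g hg] := meval_line P (coords p) (coords q).
have e0 : P.@[coords p] = g.[0].
  by rewrite -hg; apply: meval_eq => i; rewrite mul0r addr0.
rewrite e0; apply: poly_zero_off => t t_nz; rewrite -hg.
rewrite -(meval_eq _ (coords_line p q t)).
by have /hI[_] := AC _ (hA t t_nz); apply.
Qed.

Lemma closure_trans (A B : space -> Prop) p :
  (forall q, B q -> zariski_closure A q) -> zariski_closure B p ->
  zariski_closure A p.
Proof.
move=> BA [vp hB]; split=> // C closedC AC.
by apply: hB => // q /BA[_]; apply.
Qed.

Lemma closure_sub (A : space -> Prop) p : variety p -> A p -> zariski_closure A p.
Proof. by move=> vp Ap; split=> // C _; apply. Qed.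

(** The line of [degen_family] through [q] meets the orbit of [p] everywhere else,
    as points with the same codes are in one orbit. *)
Lemma closure_move (p q : space) s al e d r :
    has_code p.1 p.2 s -> perm_eq (nzparts s) (nzparts [:: (al + e - d)%N, d & r]) ->
    (d < al)%N -> (d < e)%N -> odd d = odd e ->
    has_code q.1 q.2 [:: al, e & r] ->
  zariski_closure (GL_orbit p) q.
Proof.
move=> hp ps lt_al lt_e odd_d hq; have vq := has_code_variety hq.
have [L cL eL] := has_codeP hq.
have al_gt0 : (al != 0)%N by lia.
have e_gt0 : (e != 0)%N by lia.
move: eL; rewrite /nzparts /= al_gt0 e_gt0.
case: L cL => [|[al' [x wx]] [|[e' [u wu]] L]] cL //= [] eal ee eL; subst al' e'.
have [G [N hGN]] := degen_family lt_al lt_e odd_d cL.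
apply: (@closure_line _ q (G, N)) => // t t_nz /=.
apply: (orbit_has_code (s := s) (s' := [:: (al + e - d)%N, d & r])) => //.
eexists; first exact: hGN.
rewrite /= eL /nzparts /=; case: ifP => _; case: ifP => _; rewrite ?perm_cons.
all: by rewrite filter_id.
Qed.

Lemma dom_closure (p q : space) s s' :
    has_code p.1 p.2 s -> has_code q.1 q.2 s' ->
    (forall n, tailsum n s' <= tailsum n s)%N ->
    tailsum 0 s' = tailsum 0 s -> tailsum 1 s' = tailsum 1 s ->
  zariski_closure (GL_orbit p) q.
Proof.
move=> hp hq le_s eq0 eq1; move: s le_s eq0 eq1 p hp.
have vq := has_code_variety hq.
apply: tailsum_ind => [s eq_s p hp|s al e d r ps lt_al lt_e odd_d IH p hp].
  by apply: closure_sub => //; apply: orbit_has_code hp hq eq_s.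
have [f1 [phi1 h1]] : exists (f1 : 'M[K]_(b, a)) (phi1 : 'M[K]_b), has_code f1 phi1 [:: al, e & r].
  have := has_code_dims hp; rewrite -!(tailsum_nzparts _ s).
  rewrite !(perm_tailsum _ ps) !tailsum_nzparts !tailsum_cons => -[e0 e1].
  by apply: code_exists; rewrite !tailsum_cons; lia.
apply: closure_trans (IH (f1, phi1) h1) => q1 /(has_code_orbit (p := (f1, phi1)) h1).
exact: closure_move ps lt_al lt_e odd_d.
Qed.
End Closure.

(** * Existence of chain bases *)
Section Existence.
Variables (K : fieldType) (b : nat) (phi : 'M[K]_b) (U : {vspace 'cV[K]_b}).
Hypothesis U_ker : {in U, forall x, phi *m x = 0}.

Let Phi : 'End('cV[K]_b) := linfun (mulmx phi).

Lemma PhiE x : Phi x = phi *m x. Proof. by rewrite lfunE. Qed.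

Definition chains (G : seq (nat * 'cV[K]_b)) : seq 'cV[K]_b :=
  flatten [seq traject (mulmx phi) l.2 (uphalf l.1) | l <- G].

Definition socle (G : seq (nat * 'cV[K]_b)) : seq 'cV[K]_b :=
  [seq iter l.1./2 (mulmx phi) l.2 | l <- G & odd l.1].

(** A decomposition of the [phi]-stable subspace [W] with its subspace [U :&: W]
    into pickets, without the preimages under [f]. *)
Definition adapted (W : {vspace 'cV[K]_b}) (G : seq (nat * 'cV[K]_b)) : Prop :=
  [/\ basis_of W (chains G), basis_of (U :&: W) (socle G),
      {in G, forall l, iter (uphalf l.1) (mulmx phi) l.2 = 0}
    & {in G, forall l, (0 < l.1)%N}].

Lemma chains_cat G H : chains (G ++ H) = chains G ++ chains H.
Proof. by rewrite /chains map_cat flatten_cat. Qed.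

Lemma socle_cat G H : socle (G ++ H) = socle G ++ socle H.
Proof. by rewrite /socle filter_cat map_cat. Qed.

Lemma mem_chains G l j : l \in G -> (j < uphalf l.1)%N ->
  iter j (mulmx phi) l.2 \in chains G.
Proof.
move=> lG lt_j; apply/flatten_mapP; exists l => //.
by apply/trajectP; exists j.
Qed.

Lemma chains_singletons c (X : seq 'cV[K]_b) : uphalf c = 1%N ->
  chains [seq (c, x) | x <- X] = X.
Proof.
move=> uc; rewrite /chains -map_comp -[RHS]flatten_seq1; congr flatten.
by apply: eq_map => x /=; rewrite uc.
Qed.

Lemma lift_gens (W : {vspace 'cV[K]_b}) (G : seq (nat * 'cV[K]_b)) :
  {in G, forall l, l.2 \in (Phi @: W)%VS} ->
  exists2 H, G = [seq (l.1, phi *m l.2) | l <- H] & {in H, forall l, l.2 \in W}.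
Proof.
elim: G => [|[c x] G IHG] hG; first by exists [::].
have [|H -> HW] := IHG; first by move=> l lG; apply: hG; rewrite inE lG orbT.
have /memv_imgP[y yW xy] := hG (c, x) (mem_head _ _).
exists ((c, y) :: H); first by rewrite /= -PhiE -xy.
by move=> l; rewrite inE => /predU1P[->|/HW].
Qed.

(** The chains of the image of [W] are lengthened by one vector at the top, which
    adds 2 to their codes.  New chains of code 1 are started on a complement of the
    part of [U] that is reached already, and chains of code 2 on a complement in
    the kernel.  They form a basis by rank-nullity, since the ends of the old
    chains are independent in the kernel. *)
Lemma adapted_step (W : {vspace 'cV[K]_b}) G :
  (Phi @: W <= W)%VS -> adapted (Phi @: W) G -> exists H, adapted W H.
Proof.
move=> stabW [bG sG zG pG].
have memG l : l \in G -> l.2 \in (Phi @: W)%VS.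
  move=> lG; apply: (basis_mem bG); apply: (mem_chains (j := 0) lG).
  by rewrite uphalf_gt0 pG.
have [H0 eG H0W] := lift_gens memG.
pose H1 := [seq (l.1.+2, l.2) | l <- H0].
pose lasts := [seq iter (uphalf l.1).-1 (mulmx phi) l.2 | l <- G].
pose S := <<lasts>>%VS.
pose KW := (W :&: lker Phi)%VS.
pose U1 := ((U :&: W) :\: (U :&: Phi @: W))%VS.
pose R := (KW :\: (S + U1))%VS.
have lasts_sub : subseq lasts (chains G).
  rewrite /lasts /chains; elim: (G) pG => // l G' IH pG'.
  rewrite /= -cat1s cat_subseq ?IH // => [|m mG']; last by apply: pG'; rewrite inE mG' orbT.
  rewrite sub1seq; apply/trajectP; exists (uphalf l.1).-1 => //.
  by rewrite prednK // uphalf_gt0 pG' ?mem_head.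
have free_lasts : free lasts := subseq_free lasts_sub (basis_free bG).
have dimS : \dim S = size G by rewrite /S (eqnP free_lasts) size_map.
have SW' : (S <= Phi @: W)%VS.
  by apply/span_subvP => x /(mem_subseq lasts_sub) /(basis_mem bG).
have SK : (S <= KW)%VS.
  rewrite subv_cap (subv_trans SW' stabW); apply/span_subvP => x /mapP[l lG ->].
  by rewrite memv_ker PhiE -iterS prednK ?uphalf_gt0 ?pG // zG.
have U1U : (U1 <= U :&: W)%VS := diffvSl _ _.
have U1K : (U1 <= KW)%VS.
  apply/subvP => x /(subvP U1U); rewrite !memv_cap memv_ker PhiE => /andP[xU ->].
  by rewrite U_ker ?eqxx.
have SU1 : (S :&: U1 = 0)%VS.
  apply/eqP; rewrite -subv0 -(capv_diff (U :&: W) (U :&: Phi @: W)) -/U1.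
  rewrite subv_cap capvSr subv_cap.
  rewrite (subv_trans (capvSr _ _) (subv_trans U1U (capvSl _ _))) /=.
  exact: subv_trans (capvSl _ _) SW'.
have eqU : (U :&: Phi @: W + U1 = U :&: W)%VS.
  rewrite addvC addv_diff; apply/addv_idPl; rewrite subv_cap capvSl /=.
  exact: subv_trans (capvSr _ _) stabW.
have eqK : (R + (S + U1) = KW)%VS.
  by rewrite addv_diff; apply/addv_idPl; rewrite subv_add SK.
exists (H1 ++ [seq (1%N, x) | x <- vbasis U1] ++ [seq (2%N, x) | x <- vbasis R]).
set H := H1 ++ _.
have socleH1 : socle H1 = socle G.
  rewrite /socle eG /H1 !filter_map -!map_comp.
  rewrite (eq_filter (a2 := preim fst odd)) => [|l]; last by rewrite /= negbK.
  by apply: eq_map => l; rewrite /= -iterS iterSr.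
have socleH : socle H = socle G ++ vbasis U1.
  rewrite !socle_cat socleH1; congr (_ ++ _).
  rewrite /socle !filter_map filter_predT filter_pred0 cats0 -map_comp.
  exact: map_id.
have chainsH : chains H = chains H1 ++ vbasis U1 ++ vbasis R.
  by rewrite !chains_cat !chains_singletons.
have sizeH1 : size (chains H1) = (size (chains G) + size G)%N.
  rewrite /chains !size_flatten /shape -!map_comp !sumnE !big_map eG.
  rewrite size_map -sum1_size big_map -big_split /=.
  by apply: eq_bigr => l _; rewrite !size_traject addn1.
split.
- rewrite basisEdim; apply/andP; split; last first.
    rewrite chainsH !size_cat !size_tuple sizeH1 -dimS.
    rewrite -(limg_ker_dim Phi W) -/KW -eqK dimv_disjoint_sum ?capv_diff //.
    rewrite (dimv_disjoint_sum SU1).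
    have -> : \dim (Phi @: W) = size (chains G).
      by rewrite -(span_basis bG) (eqnP (basis_free bG)).
    by move: (size (chains G)) (\dim S) (\dim U1) (\dim R); clear; lia.
  have sub1 : (<<chains H1>> <= <<chains H>>)%VS.
    by rewrite chainsH span_cat addvSl.
  have subW' : (Phi @: W <= Phi @: <<chains H1>>)%VS.
    rewrite -(span_basis bG); apply/span_subvP => x /flatten_mapP[l].
    rewrite {1}eG => /mapP[m mH0 ->] /trajectP[j /= lt_j ->].
    apply/memv_imgP; exists (iter j (mulmx phi) m.2).
      apply: memv_span; apply: (mem_chains (l := (m.1.+2, m.2))).
        by apply/mapP; exists m.
      by rewrite /=; apply: ltnW.
    by rewrite PhiE -iterSr -iterS.
  have H1W : (<<chains H1>> <= W)%VS.
    apply/span_subvP => x /flatten_mapP[l /mapP[m mH0 ->] /trajectP[j _ ->]] /=.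
    elim: j => [|j IHj] /=; first exact: H0W.
    by rewrite -PhiE; apply: (subvP stabW); apply: memv_img.
  have SH : (S <= <<chains H>>)%VS.
    apply: subv_trans sub1; apply/span_subvP => x /mapP[l].
    rewrite {1}eG => /mapP[m mH0 ->] ->; apply: memv_span => /=.
    rewrite -iterSr prednK; last first.
      by rewrite uphalf_gt0 (pG (m.1, phi *m m.2)) // eG; apply/mapP; exists m.
    apply: (mem_chains (l := (m.1.+2, m.2))) => //.
    by apply/mapP; exists m.
  have KH : (KW <= <<chains H>>)%VS.
    rewrite -eqK !subv_add SH chainsH !span_cat.
    rewrite (span_basis (vbasisP U1)) (span_basis (vbasisP R)).
    by rewrite (subv_trans (addvSr _ _) (addvSr _ _)) (subv_trans (addvSl _ _) (addvSr _ _)).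
  apply/subvP => x xW.
  have /memv_imgP[y yH Pxy] := subvP subW' _ (memv_img Phi xW).
  rewrite -(subrK y x); apply: memvD; last exact: (subvP sub1).
  apply: (subvP KH).
  rewrite memv_cap memv_ker linearB /= Pxy subrr eqxx andbT.
  by rewrite memvB // (subvP H1W).
- rewrite socleH -eqU; apply: cat_basis => //; last exact: vbasisP.
  by apply/directv_addP; rewrite capvC capv_diff.
- move=> l; rewrite !mem_cat => /or3P[] /mapP[x].
  + move=> xH0 -> /=; have xG : (x.1, phi *m x.2) \in G by rewrite eG; apply/mapP; exists x.
    by rewrite -iterS iterSr (zG _ xG).
  + by move=> /vbasis_mem /(subvP U1U); rewrite memv_cap => /andP[xU _] -> /=; apply: U_ker.
  + move=> /vbasis_mem xR -> /=; move: xR => /(subvP (diffvSl _ _)).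
    by rewrite memv_cap memv_ker PhiE => /andP[_ /eqP].
- by move=> l; rewrite !mem_cat => /or3P[] /mapP[x _ ->].
Qed.

(** Climb the chain of the images of the powers of [phi], starting at zero. *)
Lemma adapted_exists N : (forall x, iter N (mulmx phi) x = 0 :> 'cV_b) ->
  exists G, adapted fullv G.
Proof.
move=> nilN; pose W k := iter k (lfun_img Phi) fullv.
have decW k : (W k.+1 <= W k)%VS.
  by elim: k => [|k IHk]; [apply: subvf | apply: limgS].
have memW k x : x \in W k -> exists y, x = iter k (mulmx phi) y.
  elim: k x => [|k IHk] x; first by exists x.
  by move=> /memv_imgP[y /IHk[z ->] ->]; exists z; rewrite PhiE.
have WN : W N = 0%VS.
  apply/eqP; rewrite -subv0; apply/subvP => x /memW[y ->].
  by rewrite nilN mem0v.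
suff: forall k, (k <= N)%N -> exists G, adapted (W (N - k)%N) G.
  by move=> /(_ N (leqnn N)); rewrite subnn.
elim=> [_|k IHk lt_k].
  exists [::]; rewrite subn0 WN /adapted capv0.
  by split=> //; rewrite /chains /socle /= basisEdim sub0v.
have [G] := IHk (ltnW lt_k).
have -> : (N - k = (N - k.+1).+1)%N by lia.
exact/adapted_step/decW.
Qed.

End Existence.

Lemma code_of_point (K : fieldType) a b (f : 'M[K]_(b, a)) phi N :
    (forall x, iter N (mulmx phi) x = 0 :> 'cV_b) -> phi *m f = 0 ->
    (exists M : 'M_(a, b), M *m f = 1%:M) ->
  exists s, has_code f phi s.
Proof.
move=> nil0 phif [M Mf].
pose F : 'Hom('cV[K]_a, 'cV[K]_b) := linfun (mulmx f).
pose G : 'Hom('cV[K]_b, 'cV[K]_a) := linfun (mulmx M).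
have F_ker : {in limg F, forall x, phi *m x = 0}.
  by move=> _ /memv_imgP[x _ ->]; rewrite lfunE /= mulmxA phif mul0mx.
have [L [bL sL zL _]] := adapted_exists F_ker nil0.
exists (unzip1 L), [seq (l.1, (l.2, M *m iter l.1./2 (mulmx phi) l.2)) | l <- L]; last first.
  by rewrite /unzip1 -map_comp.
have sL' : basis_of (limg F) (socle phi L) by rewrite -[limg F]capvf.
have fM x : x \in limg F -> f *m (M *m x) = x.
  by move=> /memv_imgP[y _ ->]; rewrite lfunE /= (mulmxA M) Mf mul1mx.
split.
- by move: bL; rewrite /chains /chain_vecs -map_comp.
- have -> : sub_vecs [seq (l.1, (l.2, M *m iter l.1./2 (mulmx phi) l.2)) | l <- L]
      = map G (socle phi L).
    rewrite /sub_vecs /socle filter_map -!map_comp; apply: eq_map => l.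
    by rewrite /= lfunE.
  have <- : (G @: limg F)%VS = fullv.
    apply/vspaceP => x; rewrite memvf; apply/memv_imgP.
    exists (F x); first by rewrite memv_img ?memvf.
    by rewrite !lfunE /= mulmxA Mf mul1mx.
  apply: limg_basis_of => //; apply/eqP; rewrite -subv0; apply/subvP => x.
  rewrite memv_cap memv_ker lfunE /= memv0 => /andP[xF /eqP Mx0].
  by rewrite -(fM x xF) Mx0 mulmx0.
- by move=> l /mapP[m mL ->]; apply: zL.
- move=> l /mapP[m mL ->] /= om; apply: fM; apply: (basis_mem sL').
  by apply/mapP; exists m; rewrite // mem_filter om.
Qed.

(** * Degeneration implies the hom order *)
Section HomInvariance.
Variable K : fieldType.
Implicit Types X Y Z : triple K.

Local Notation homT X Y :=
  ('M[K]_(dim1 Y, dim1 X) * 'M[K]_(dim2 Y, dim2 X))%type.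

Definition hom_post Z X Y (th : homT X Y) (psi : homT Z X) : homT Z Y :=
  (th.1 *m psi.1, th.2 *m psi.2).

Lemma hom_post_is_linear Z X Y (th : homT X Y) : linear (@hom_post Z X Y th).
Proof.
by move=> k u v; rewrite /hom_post; congr (_, _); rewrite /= mulmxDr -scalemxAr.
Qed.

HB.instance Definition _ Z X Y th :=
  GRing.isLinear.Build K _ _ _ (@hom_post Z X Y th) (@hom_post_is_linear Z X Y th).

Definition hom_pre Z X Y (th : homT Z X) (psi : homT X Y) : homT Z Y :=
  (psi.1 *m th.1, psi.2 *m th.2).

Lemma hom_pre_is_linear Z X Y (th : homT Z X) : linear (@hom_pre Z X Y th).
Proof.
by move=> k u v; rewrite /hom_pre; congr (_, _); rewrite /= mulmxDl -scalemxAl.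
Qed.

HB.instance Definition _ Z X Y th :=
  GRing.isLinear.Build K _ _ _ (@hom_pre Z X Y th) (@hom_pre_is_linear Z X Y th).

Lemma dim_hom_post Z X Y (th : homT X Y) (th' : homT Y X) :
    is_hom th -> th'.1 *m th.1 = 1%:M -> th'.2 *m th.2 = 1%:M ->
  (\dim (HomS Z X) <= \dim (HomS Z Y))%N.
Proof.
move=> [h1 h2 h3] e1 e2; pose F := linfun (@hom_post Z X Y th).
rewrite -(limg_dim_eq (f := F)); last first.
  apply/eqP; rewrite -subv0; apply/subvP => psi; rewrite memv_cap => /andP[_].
  rewrite memv_ker lfunE memv0 => /eqP[p1 p2]; apply/eqP; case: psi p1 p2 => u v /= p1 p2.
  by congr (_, _); rewrite -[LHS]mul1mx -?e1 -?e2 -mulmxA ?p1 ?p2 mulmx0.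
apply/dimvS/subvP => _ /memv_imgP[psi /HomSP[q1 q2 q3] ->].
rewrite lfunE; apply/HomSP; split=> /=.
- by rewrite -mulmxA q1 !mulmxA h1.
- by rewrite -mulmxA q2 !mulmxA h2.
- by rewrite mulmxA h3 -!mulmxA q3.
Qed.

Lemma dim_hom_pre Z X Y (th : homT Z X) (th' : homT X Z) :
    is_hom th -> th.1 *m th'.1 = 1%:M -> th.2 *m th'.2 = 1%:M ->
  (\dim (HomS X Y) <= \dim (HomS Z Y))%N.
Proof.
move=> [h1 h2 h3] e1 e2; pose F := linfun (@hom_pre Z X Y th).
rewrite -(limg_dim_eq (f := F)); last first.
  apply/eqP; rewrite -subv0; apply/subvP => psi; rewrite memv_cap => /andP[_].
  rewrite memv_ker lfunE memv0 => /eqP[p1 p2]; apply/eqP; case: psi p1 p2 => u v /= p1 p2.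
  by congr (_, _); rewrite -[LHS]mulmx1 -?e1 -?e2 mulmxA ?p1 ?p2 mul0mx.
apply/dimvS/subvP => _ /memv_imgP[psi /HomSP[q1 q2 q3] ->].
rewrite lfunE; apply/HomSP; split=> /=.
- by rewrite -mulmxA h1 !mulmxA q1.
- by rewrite -mulmxA h2 !mulmxA q2.
- by rewrite mulmxA q3 -!mulmxA h3.
Qed.

Lemma isomorphic_dim_hom X Z Y : isomorphic X Z -> \dim (HomS X Y) = \dim (HomS Z Y).
Proof.
case=> psi [chi [hpsi hchi [e1 e1'] [e2 e2']]]; apply/eqP; rewrite eqn_leq.
by rewrite (dim_hom_pre _ hchi e1 e2) (dim_hom_pre _ hpsi e1' e2').
Qed.

End HomInvariance.

Section PolynomialFunctions.
Variables (K : fieldType) (a b : nat).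
Local Notation space := ('M[K]_(b, a) * 'M[K]_b)%type.

Definition polyfun (F : space -> K) : Prop :=
  exists Q : {mpoly K[b * a + b * b]}, forall p, F p = Q.@[coords p].

Lemma polyfun_const c : polyfun (fun=> c).
Proof. by exists c%:MP => p; rewrite mevalC. Qed.

Lemma polyfunD F G : polyfun F -> polyfun G -> polyfun (fun p => F p + G p).
Proof. by move=> [P hP] [Q hQ]; exists (P + Q) => p; rewrite mevalD hP hQ. Qed.

Lemma polyfunM F G : polyfun F -> polyfun G -> polyfun (fun p => F p * G p).
Proof. by move=> [P hP] [Q hQ]; exists (P * Q) => p; rewrite mevalM hP hQ. Qed.

Lemma polyfun_sum I (r : seq I) (F : I -> space -> K) :
  (forall i, polyfun (F i)) -> polyfun (fun p => \sum_(i <- r) F i p).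
Proof.
move=> hF; elim: r => [|i r [Q hQ]].
  by exists 0 => p; rewrite big_nil meval0.
have [P hP] := hF i; exists (P + Q) => p.
by rewrite big_cons mevalD hP hQ.
Qed.

Lemma polyfun_prod I (r : seq I) (F : I -> space -> K) :
  (forall i, polyfun (F i)) -> polyfun (fun p => \prod_(i <- r) F i p).
Proof.
move=> hF; elim: r => [|i r [Q hQ]].
  by exists 1 => p; rewrite big_nil meval1.
have [P hP] := hF i; exists (P * Q) => p.
by rewrite big_cons mevalM hP hQ.
Qed.

Definition polymx m n (A : space -> 'M[K]_(m, n)) : Prop :=
  forall i j, polyfun (fun p => A p i j).

Lemma polymx_const m n (A : 'M[K]_(m, n)) : polymx (fun=> A).
Proof. by move=> i j; apply: polyfun_const. Qed.

Lemma polymx_fst : polymx (fun p => p.1).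
Proof.
move=> i j; exists 'X_(lshift _ (mxvec_index i j)) => p.
by rewrite mevalXU /coords row_mxEl mxvecE.
Qed.

Lemma polymx_snd : polymx (fun p => p.2).
Proof.
move=> i j; exists 'X_(rshift _ (mxvec_index i j)) => p.
by rewrite mevalXU /coords row_mxEr mxvecE.
Qed.

Lemma eq_polyfun F G : F =1 G -> polyfun F -> polyfun G.
Proof. by move=> FG [Q hQ]; exists Q => p; rewrite -FG. Qed.

Lemma polymx_mul m n l (A : space -> 'M[K]_(m, n)) (B : space -> 'M[K]_(n, l)) :
  polymx A -> polymx B -> polymx (fun p => A p *m B p).
Proof.
move=> hA hB i j; apply: (eq_polyfun (F := fun p => \sum_k A p i k * B p k j)).
  by move=> p; rewrite mxE.
by apply: polyfun_sum => k; apply: polyfunM.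
Qed.

Lemma polymx_sub m n (A B : space -> 'M[K]_(m, n)) :
  polymx A -> polymx B -> polymx (fun p => A p - B p).
Proof.
move=> hA hB i j; apply: (eq_polyfun (F := fun p => A p i j + (-1) * B p i j)).
  by move=> p; rewrite !mxE mulN1r.
by apply: polyfunD => //; apply: polyfunM => //; apply: polyfun_const.
Qed.

Lemma polyfun_det n (A : space -> 'M[K]_n) : polymx A -> polyfun (fun p => \det (A p)).
Proof.
move=> hA; apply: polyfun_sum => s; apply: polyfunM; first exact: polyfun_const.
by apply: polyfun_prod => i.
Qed.

Lemma polyfun_scalar m n (lam : 'M[K]_(m, n) -> K) (A : space -> 'M[K]_(m, n)) :
    (forall k u v, lam (k *: u + v) = k * lam u + lam v) ->
  polymx A -> polyfun (fun p => lam (A p)).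
Proof.
move=> linlam hA.
pose lamL : {scalar 'M[K]_(m, n)} :=
  HB.pack lam (GRing.isLinear.Build _ _ _ _ lam linlam).
apply: (eq_polyfun (F := fun p => \sum_i \sum_j A p i j * lam (delta_mx i j))).
  move=> p; transitivity (lamL (\sum_i \sum_j A p i j *: delta_mx i j)).
    rewrite linear_sum.
    apply: eq_bigr => i _; rewrite linear_sum; apply: eq_bigr => j _.
    by rewrite linearZ.
  by rewrite -matrix_sum_delta.
by do 2!apply: polyfun_sum => ?; apply: polyfunM => //; apply: polyfun_const.
Qed.

Lemma closure_polyfun (A : space -> Prop) F q :
  polyfun F -> (forall p, A p -> variety p) -> (forall p, A p -> F p = 0) ->
  zariski_closure A q -> F q = 0.
Proof.
move=> [Q hQ] Av AF [vq hq].
pose C p := variety p /\ forall P, P = Q -> P.@[coords p] = 0.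
have [|p Ap|_ /(_ Q erefl)] := hq C; last by rewrite -hQ.
  by exists (eq Q) => p; split=> -[vp hp]; split=> // P eP; apply: hp.
by split=> [|P ->]; [apply: Av | rewrite -hQ AF].
Qed.

End PolynomialFunctions.

Section Semicontinuity.
Variables (K : fieldType) (a b : nat).
Local Notation space := ('M[K]_(b, a) * 'M[K]_b)%type.

Definition point_triple (p : space) : triple K := @Triple K a b 0 p.2 p.1.

Lemma variety_orbit (p q : space) : variety p -> GL_orbit p q -> variety q.
Proof.
case: p => f phi [/= nil0 z0 r0] [g [h [ug uh ->]]]; split=> /=.
- have powE n : (h *m phi *m invmx h) ^+ n = h *m phi ^+ n *m invmx h.
    elim: n => [|n IHn]; first by rewrite !expr0 mulmx1 mulmxV.
    by rewrite !exprS -!mulmxE IHn !mulmxA mulmxKV.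
  by rewrite powE nil0 mulmx0 mul0mx.
- by rewrite !mulmxA mulmxKV // -(mulmxA h) z0 mulmx0 mul0mx.
- by rewrite mxrankMfree ?row_free_unit ?unitmx_inv // eqmxMfull ?row_full_unit.
Qed.

Lemma GL_orbit_dim_hom Z (p q : space) :
  GL_orbit p q ->
  (\dim (HomS Z (point_triple p)) <= \dim (HomS Z (point_triple q)))%N.
Proof.
move=> [g [h [ug uh ->]]].
apply: (@dim_hom_post _ Z (point_triple p) (point_triple (GL_act g h p))
  (g, h) (invmx g, invmx h)) => /=.
- by split; rewrite /= ?mulmx0 ?mul0mx // mulmxKV.
- by rewrite mulVmx.
- by rewrite mulVmx.
Qed.

Lemma hom_defectE (X Y : triple K) psi :
  linfun (@hom_defect K X Y) psi = hom_defect psi.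
Proof. by rewrite lfunE. Qed.

(** Upper semicontinuity of the dimension of the kernel: the nonvanishing of a
    determinant keeps the images of [k] vectors free on an open set. *)
Lemma closure_dim_ker (D E : vectType K) (f : space -> 'Hom(D, E))
    (A : space -> Prop) r q :
    (forall (lam : {scalar E}) w, polyfun (fun x => lam (f x w))) ->
    (forall p, A p -> variety p) ->
    (forall p, A p -> r <= \dim (lker (f p)))%N ->
    zariski_closure A q ->
  (r <= \dim (lker (f q)))%N.
Proof.
move=> polyF vA kerA cq.
have dimf x : (\dim (lker (f x)) + \dim (limg (f x)))%N = \dim {: D}.
  by have := limg_ker_dim (f x) fullv; rewrite capfv.
rewrite leqNgt; apply/negP => lt_r.
pose X := vbasis (limg (f q)); set k := \dim (limg (f q)) in X.
have freeX : free X := basis_free (vbasisP _).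
have [w hw] : exists w : 'I_k -> D, forall i, f q (w i) = X`_i.
  exists (fun i => (f q)^-1%VF X`_i) => i.
  by rewrite limg_lfunVK // vbasis_mem // mem_nth // size_tuple.
pose M x : 'M[K]_k := \matrix_(i, j) coord X i (f x (w j)).
have polyM : polymx M.
  move=> i j; apply: (eq_polyfun (F := fun x => coord X i (f x (w j)))).
    by move=> x; rewrite mxE.
  exact: polyF.
have detq : \det (M q) = 1.
  have -> : M q = 1%:M.
    by apply/matrixP => i j; rewrite !mxE hw coord_free // eq_sym.
  by rewrite det1.
suff: \det (M q) = 0 by rewrite detq => /eqP; rewrite oner_eq0.
apply: (closure_polyfun (F := fun x => \det (M x))) cq => // [|x Ax].
  exact: polyfun_det.
apply/eqP/negPn/negP => ndet.
have freeY : free [tuple f x (w i) | i < k].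
  apply/freeP => c hc i.
  have unitM : M x \in unitmx by rewrite unitmxE unitfE.
  have : M x *m \col_j c j = 0.
    apply/matrixP => l l'; rewrite !mxE -[RHS](linear0 (coord X l)) -hc linear_sum.
    apply: eq_bigr => j _; rewrite !mxE -tnth_nth tnth_mktuple linearZ.
    exact: mulrC.
  move=> /(congr1 (mulmx (invmx (M x)))); rewrite mulKmx // mulmx0.
  by move=> /matrixP/(_ i 0); rewrite !mxE.
have : (k <= \dim (limg (f x)))%N.
  have <- : \dim <<[tuple f x (w i) | i < k]>> = k by rewrite (eqnP freeY) size_tuple.
  apply/dimvS/span_subvP => y /tnthP[i ->]; rewrite tnth_mktuple.
  by apply: memv_img; apply: memvf.
by have := kerA x Ax; have := dimf x; have := dimf q; lia.
Qed.

Lemma closure_dim_hom Z (p q : space) :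
    variety p -> zariski_closure (GL_orbit p) q ->
  (\dim (HomS Z (point_triple p)) <= \dim (HomS Z (point_triple q)))%N.
Proof.
move=> vp cq.
pose D : vectType K := ('M[K]_(a, dim1 Z) * 'M[K]_(b, dim2 Z))%type.
pose E : vectType K := ('M[K]_(a, dim1 Z) * 'M[K]_(b, dim2 Z) * 'M[K]_(b, dim1 Z))%type.
pose F x : 'Hom(D, E) := linfun (@hom_defect K Z (point_triple x)).
refine (@closure_dim_ker D E F (GL_orbit p) _ q _ _ _ cq).
- move=> lam [w1 w2].
  pose d1 : 'M[K]_(a, dim1 Z) := w1 *m T1 Z - 0 *m w1.
  pose d2 (x : space) := w2 *m T2 Z - x.2 *m w2.
  pose d3 (x : space) := x.1 *m w1 - w2 *m emb Z.
  have FE x : F x (w1, w2) = (d1, d2 x, d3 x).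
    exact (hom_defectE (X := Z) (Y := point_triple x) (w1, w2)).
  have lamE (u1 : 'M[K]_(a, dim1 Z)) (u2 : 'M[K]_(b, dim2 Z)) (u3 : 'M[K]_(b, dim1 Z)) :
      lam (u1, 0, 0) + (lam (0, u2, 0) + lam (0, 0, u3)) = lam (u1, u2, u3).
    rewrite -!linearD; congr (lam _).
    by congr (_, _, _) => /=; rewrite ?addr0 ?add0r.
  apply: (eq_polyfun (F := fun x => lam (d1, 0, 0) + (lam (0, d2 x, 0) + lam (0, 0, d3 x)))).
    by move=> x; rewrite FE lamE.
  apply: polyfunD; first exact: polyfun_const.
  apply: polyfunD.
    apply: (polyfun_scalar (lam := fun M => lam (0, M, 0))).
      move=> c u v; rewrite -[_ * _]linearZ -linearD; congr (lam _).
      by congr (_, _, _) => /=; rewrite ?scaler0 ?addr0.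
    apply: polymx_sub; first exact: polymx_const.
    by apply: polymx_mul; [exact: polymx_snd | exact: polymx_const].
  apply: (polyfun_scalar (lam := fun M => lam (0, 0, M))).
    move=> c u v; rewrite -[_ * _]linearZ -linearD; congr (lam _).
    by congr (_, _, _) => /=; rewrite ?scaler0 ?addr0.
  apply: polymx_sub; last exact: polymx_const.
  by apply: polymx_mul; [exact: polymx_fst | exact: polymx_const].
- by move=> x; apply: variety_orbit.
- by move=> x ox; exact (GL_orbit_dim_hom Z ox).
Qed.
End Semicontinuity.

(** * Homomorphisms from pickets *)
Section SubChains.
Variables (K : fieldType) (a b : nat) (f : 'M[K]_(b, a)) (phi : 'M[K]_b).

(** The kernel of this map, for [m.-1], is the space of homomorphisms from [P_1^m]:
    the generator goes to [x], and the basis vector of the subspace to [y]. *)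
Definition rel_map m (xy : 'cV[K]_b * 'cV[K]_a) : 'cV[K]_b :=
  phi ^+ m *m xy.1 - f *m xy.2.

Lemma rel_map_is_linear m : linear (rel_map m).
Proof.
move=> k u v; rewrite /rel_map /= !mulmxDr -!scalemxAr opprD addrACA.
by rewrite scalerBr.
Qed.

HB.instance Definition _ m :=
  GRing.isLinear.Build K _ _ _ (rel_map m) (rel_map_is_linear m).

Variable L : seq (gen K a b).
Hypothesis cL : chain_basis f phi L.

(** The vectors left in each chain of code [c] when the first [k c] are dropped. *)
Definition cut_chains (k : nat -> nat) : seq 'cV[K]_b :=
  flatten [seq drop (k l.1) (traject (mulmx phi) l.2.1 (uphalf l.1)) | l <- L].

Lemma dim_cut_chains (k : nat -> nat) (W : {vspace 'cV[K]_b}) :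
    {in L, forall l j, (k l.1 <= j < uphalf l.1)%N -> iter j (mulmx phi) l.2.1 \in W} ->
    (W <= <<cut_chains k>>)%VS ->
  \dim W = (\sum_(c <- unzip1 L) (uphalf c - k c))%N.
Proof.
case: cL => bV _ _ _ hW subW.
have sub : subseq (cut_chains k) (chain_vecs phi L).
  rewrite /cut_chains /chain_vecs; elim: (L) => // l L' IH /=.
  by rewrite cat_subseq // drop_subseq.
have -> : W = <<cut_chains k>>%VS.
  apply: subv_anti; rewrite subW /=; apply/span_subvP => x.
  move=> /flatten_mapP[l lL /(nthP 0)[j]]; rewrite size_drop size_traject => lt_j <-.
  have lt_kj : (k l.1 + j < uphalf l.1)%N by rewrite -ltn_subRL.
  rewrite nth_drop (set_nth_default l.2.1) ?size_traject // nth_traject //.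
  by apply: hW => //; rewrite leq_addr.
rewrite (eqnP (subseq_free sub (basis_free bV))) size_flatten /shape -map_comp sumnE !big_map.
by apply: eq_bigr => l _; rewrite /= size_drop size_traject.
Qed.

Lemma mem_cut_chains k l j : l \in L -> (k l.1 <= j)%N ->
  iter j (mulmx phi) l.2.1 \in <<cut_chains k>>%VS.
Proof.
case: cL => _ _ zL _ lL le_j; have [lt_j|ge_j] := ltnP j (uphalf l.1); last first.
  by rewrite -(subnK ge_j) iterD zL // iter_mulmx0 mem0v.
apply: memv_span; apply/flatten_mapP; exists l => //.
rewrite -(nth_traject _ lt_j) -[j in nth _ _ j](subnKC le_j) -nth_drop.
by rewrite mem_nth // size_drop size_traject ltn_sub2r // (leq_ltn_trans le_j).
Qed.

Lemma expr_iterE m j (v : 'cV[K]_b) :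
  phi ^+ m *m iter j (mulmx phi) v = iter (m + j) (mulmx phi) v.
Proof. by rewrite -iter_mulmxX iterD. Qed.

Lemma dim_limg_power m :
  \dim (limg (linfun (mulmx (phi ^+ m) : 'cV[K]_b -> 'cV[K]_b))) = tailsum m.*2 (unzip1 L).
Proof.
case: (cL) => bV _ _ _.
rewrite (dim_cut_chains (k := fun=> m)).
- by apply: eq_bigr => c _; lia.
- move=> l lL j /andP[le_j lt_j]; apply/memv_imgP.
  exists (iter (j - m) (mulmx phi) l.2.1); first exact: memvf.
  by rewrite lfunE /= expr_iterE subnKC.
- apply/subvP => _ /memv_imgP[x _ ->]; rewrite lfunE /=.
  apply: (mulmx_span (X := chain_vecs phi L)); first by rewrite (span_basis bV) memvf.
  move=> y /chain_vecsP[l lL [j _ ->]]; rewrite expr_iterE.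
  by apply: mem_cut_chains => //; apply: leq_addr.
Qed.

(** The image is spanned by the chain vectors of index at least [m] and by the last
    vectors of the chains with odd code. *)
Lemma dim_limg_rel_map m :
  \dim (limg (linfun (rel_map m))) = (tailsum m.*2.+1 (unzip1 L) + a)%N.
Proof.
case: (cL) => bV bW _ fL.
rewrite (dim_cut_chains (k := fun c => if odd c then minn m c./2 else m)).
- have suma : (\sum_(c <- unzip1 L) odd c = a)%N.
    apply: etrans (size_basis_cV bW).
    by rewrite size_sub_vecs -sum1_count [RHS]big_mkcond; apply: eq_bigr => c _; case: odd.
  apply: etrans (congr1 (addn _) suma); rewrite /tailsum -big_split; apply: eq_bigr => c _ /=.
  by case: ifP => oc; lia.
- move=> l lL j /andP[le_j lt_j]; apply/memv_imgP.
  have [le_m|lt_m] := leqP m j.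
    exists (iter (j - m) (mulmx phi) l.2.1, 0); first exact: memvf.
    by rewrite lfunE /= /rel_map /= expr_iterE subnKC // mulmx0 subr0.
  have [ol ej] : odd l.1 /\ j = l.1./2.
    by move: (l.1) le_j lt_j lt_m; clear => c; case: ifP => ol; lia.
  exists (0, - l.2.2); first exact: memvf.
  by rewrite lfunE /= /rel_map /= mulmx0 sub0r mulmxN opprK fL // ej.
- apply/subvP => _ /memv_imgP[x _ ->]; rewrite lfunE /= /rel_map memvB //.
    apply: (mulmx_span (X := chain_vecs phi L)); first by rewrite (span_basis bV) memvf.
    move=> y /chain_vecsP[l lL [j _ ->]]; rewrite expr_iterE.
    by apply: mem_cut_chains => //; case: ifP => _; rewrite ?geq_min leq_addr.
  apply: (mulmx_span (X := sub_vecs L)); first by rewrite (span_basis bW) memvf.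
  move=> y /mapP[l]; rewrite mem_filter => /andP[ol lL] ->.
  by rewrite fL //; apply: mem_cut_chains => //; rewrite ol geq_minr.
Qed.

End SubChains.

Section PicketHom.
Variables (K : fieldType) (a b : nat) (f : 'M[K]_(b, a)) (phi : 'M[K]_b) (m : nat).
Hypothesis m_gt0 : (0 < m)%N.

Let e0 : 'cV[K]_m := \col_i (i == 0%N :> nat)%:R.

Definition colsmx (x : 'cV[K]_b) : 'M[K]_(b, m) :=
  \matrix_(i, j) (iter j (mulmx phi) x) i 0.

Lemma colsmx_gv x : colsmx x *m e0 = x.
Proof.
apply/matrixP => i j; rewrite !mxE (bigD1 (Ordinal m_gt0)) //= !mxE mulr1.
rewrite big1 ?addr0 ?ord1 // => k; rewrite -val_eqE /= => /negPf nk.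
by rewrite !mxE nk mulr0.
Qed.

Lemma intertwine_iter (psi : 'M[K]_(b, m)) j :
  psi *m cyclicT K m = phi *m psi ->
  iter j (mulmx phi) (psi *m e0) = psi *m \col_i (i == j :> nat)%:R.
Proof. by move=> hpsi; rewrite (iter_intertwine _ _ hpsi) iter_cyclicT. Qed.

Lemma intertwine_nil (psi : 'M[K]_(b, m)) :
  psi *m cyclicT K m = phi *m psi -> iter m (mulmx phi) (psi *m e0) = 0.
Proof.
move=> hpsi; rewrite intertwine_iter //.
suff -> : (\col_(i < m) (i == m :> nat)%:R : 'cV[K]_m) = 0 by rewrite mulmx0.
by apply/matrixP => i j; rewrite !mxE ltn_eqF.
Qed.

Lemma intertwine_cols (psi : 'M[K]_(b, m)) :
  psi *m cyclicT K m = phi *m psi -> psi = colsmx (psi *m e0).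
Proof.
move=> hpsi; apply/matrixP => i j; rewrite mxE intertwine_iter // mxE.
rewrite (bigD1 j) //= mxE eqxx mulr1 big1 ?addr0 // => k.
by rewrite -val_eqE /= => /negPf nk; rewrite mxE nk mulr0.
Qed.

Lemma cols_intertwine x : iter m (mulmx phi) x = 0 ->
  colsmx x *m cyclicT K m = phi *m colsmx x.
Proof.
move=> nil_x; apply/matrixP => i j; rewrite mxE.
have -> : (phi *m colsmx x) i j = (iter j.+1 (mulmx phi) x) i 0.
  by rewrite iterS !mxE; apply: eq_bigr => k _; rewrite !mxE.
have [lt_j|ge_j] := ltnP j.+1 m; last first.
  have -> : j.+1 = m by apply/eqP; rewrite eqn_leq ltn_ord.
  rewrite nil_x mxE big1 // => k _; rewrite !mxE.
  by rewrite ltn_eqF ?mulr0 // (leq_trans (ltn_ord k)).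
have -> : (iter j.+1 (mulmx phi) x) i 0 = colsmx x i (Ordinal lt_j) by rewrite [RHS]mxE.
rewrite (bigD1 (Ordinal lt_j)) //= [cyclicT _ _ _ _]mxE eqxx mulr1.
have -> : \sum_(k < m | k != Ordinal lt_j) colsmx x i k * cyclicT K m k j = 0.
  rewrite big1 // => k; rewrite -val_eqE /= => /negPf nk.
  by rewrite [cyclicT _ _ _ _]mxE nk mulr0.
by rewrite addr0.
Qed.

Local Notation Y := (point_triple (f, phi)).

(** Evaluation at the generator of the picket, which determines a homomorphism. *)
Definition ev0 (psi : 'M[K]_(a, 0) * 'M[K]_(b, m)) : 'cV[K]_b := psi.2 *m e0.

Lemma ev0_is_linear : linear ev0.
Proof. by move=> k u v; rewrite /ev0 /= mulmxDl -scalemxAl. Qed.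

HB.instance Definition _ := GRing.isLinear.Build K _ _ _ ev0 ev0_is_linear.

Lemma dim_hom_picket0 :
  (\dim (HomS (picket K 0 m) Y)
   + \dim (limg (linfun (mulmx (phi ^+ m) : 'cV[K]_b -> 'cV[K]_b))))%N = b.
Proof.
pose E := linfun ev0.
have EE psi : E psi = ev0 psi by exact: lfunE.
pose H : {vspace 'M[K]_(a, 0) * 'M[K]_(b, m)} := HomS (picket K 0 m) Y.
have HP psi : reflect (is_hom (X := picket K 0 m) (Y := Y) psi) (psi \in H).
  exact (HomSP psi).
rewrite -/H -(limg_dim_eq (f := E) (U := H)).
  have -> : (E @: H)%VS = (fullv :&: lker (linfun (mulmx (phi ^+ m) : 'cV[K]_b -> 'cV[K]_b)))%VS.
    apply/vspaceP => x; rewrite capfv memv_ker lfunE /= -iter_mulmxX.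
    apply/memv_imgP/eqP => [[psi /HP[_ h2 _] ->]|nil_x].
      by rewrite EE; apply: intertwine_nil.
    exists (0, colsmx x); last by rewrite EE /ev0 colsmx_gv.
    apply/HP; split=> /=; first by rewrite mul0mx mulmx0.
      exact: cols_intertwine.
    by apply/matrixP => i [].
  by rewrite limg_ker_dim dim_cV.
apply/eqP; rewrite -subv0; apply/subvP => -[u v]; rewrite memv_cap memv_ker EE.
move=> /andP[/HP[_ /= h2 _] /eqP]; rewrite /ev0 /= => v0; rewrite memv0.
rewrite (intertwine_cols h2) v0; apply/eqP; congr (_, _); last first.
  by apply/matrixP => i j; rewrite !mxE iter_mulmx0 mxE.
by apply/matrixP => i [].
Qed.

Definition ev1 (psi : 'M[K]_(a, 1) * 'M[K]_(b, m)) : 'cV[K]_b * 'cV[K]_a :=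
  (psi.2 *m e0, psi.1).

Lemma ev1_is_linear : linear ev1.
Proof. by move=> k u v; rewrite /ev1 /=; congr (_, _); rewrite /= mulmxDl -scalemxAl. Qed.

HB.instance Definition _ := GRing.isLinear.Build K _ _ _ ev1 ev1_is_linear.

Lemma mul_picket_emb (psi : 'M[K]_(b, m)) :
  psi *m emb (picket K 1 m) = psi *m \col_i (i == m.-1 :> nat)%:R.
Proof.
congr (_ *m _); apply/matrixP => i j; rewrite !mxE; congr (_%:R).
by move: (nat_of_ord i) => k; rewrite -[in LHS](prednK m_gt0) eqSS.
Qed.

Lemma dim_hom_picket1 : phi *m f = 0 ->
  (\dim (HomS (picket K 1 m) Y) + \dim (limg (linfun (rel_map f phi m.-1))))%N
  = (b + a)%N.
Proof.
move=> phif; pose E := linfun ev1.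
have EE psi : E psi = ev1 psi by exact: lfunE.
pose H : {vspace 'M[K]_(a, 1) * 'M[K]_(b, m)} := HomS (picket K 1 m) Y.
have HP psi : reflect (is_hom (X := picket K 1 m) (Y := Y) psi) (psi \in H).
  exact (HomSP psi).
rewrite -/H -(limg_dim_eq (f := E) (U := H)).
  have -> : (E @: H)%VS = (fullv :&: lker (linfun (rel_map f phi m.-1)))%VS.
    apply/vspaceP => -[x y]; rewrite capfv memv_ker lfunE /= /rel_map /= subr_eq0 -iter_mulmxX.
    apply/memv_imgP/eqP => [[[u v] /HP[_ /= h2 h3]]|hxy].
      rewrite EE => -[-> ->]; rewrite intertwine_iter // h3.
      by rewrite -mul_picket_emb.
    have nil_x : iter m (mulmx phi) x = 0.
      by rewrite -(prednK m_gt0) iterS hxy mulmxA phif mul0mx.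
    exists (y, colsmx x); last by rewrite EE /ev1 colsmx_gv.
    have hx := cols_intertwine nil_x.
    apply/HP; split=> /=; [|exact: hx|].
      suff -> : cyclicT K 1 = 0 by rewrite mulmx0 mul0mx.
      by apply/matrixP => i j; rewrite !mxE !ord1.
    have := mul_picket_emb (colsmx x) => /= ->.
    by rewrite -intertwine_iter // colsmx_gv hxy.
  by rewrite limg_ker_dim dimvf; apply: (congr2 addn); apply: muln1.
apply/eqP; rewrite -subv0; apply/subvP => -[u v]; rewrite memv_cap memv_ker EE.
move=> /andP[/HP[_ /= h2 _] /eqP]; rewrite /ev1 /= => -[v0 u0]; rewrite memv0.
rewrite (intertwine_cols h2) v0 u0; apply/eqP; congr (_, _).
by apply/matrixP => i j; rewrite !mxE iter_mulmx0 mxE.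
Qed.

End PicketHom.

(** * Types, and proof of the equivalence *)
Section PicketObjects.
Variable K : fieldType.

Lemma partition_of_part c : exists (lam : Defs.partition)
    (J : 'M[K]_(weight lam, c)) (J' : 'M[K]_(c, weight lam)),
  [/\ J *m J' = 1%:M, J' *m J = 1%:M & NT K lam *m J = J *m cyclicT K c].
Proof.
have [->|c_gt0] := posnP c.
  have ok : sorted geq [::] && (0%N \notin [::]) by [].
  have w0 : weight (Partition ok) = 0%N by rewrite /weight big_ord0.
  exists (Partition ok), 0, 0; split; apply/matrixP => i j.
  - by have := ltn_ord i; rewrite [X in (_ < X)%N]w0.
  - by case: i.
  - by case: j.
have ok : sorted geq [:: c] && (0%N \notin [:: c]) by rewrite /= inE eq_sym -lt0n.
pose lam := Partition ok.
exists lam, (block_inc K (fun i : 'I_(size lam) => part lam i) ord0),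
  (submxcol (1%:M : 'M_(weight lam)) ord0); split.
- have := sum_block_inc (p := fun i : 'I_(size lam) => part lam i) (1%:M : 'M[K]_(weight lam)).
  by move=> {2}<-; symmetry; apply: big_ord1.
- pose p (i : 'I_(size lam)) := part lam i.
  have e1 : submxcol 1%:M ord0 *m block_inc K p ord0 = 1%:M.
    by rewrite submxcol_mul mul1mx submxcol_block_inc eqxx conform_mx_id.
  exact e1.
- exact: (block_inc_diag (fun i : 'I_(size lam) => cyclicT K (part lam i)) ord0).
Qed.

Lemma picket_emb_inj eps m : (eps <= 1)%N -> (eps <= m)%N ->
  injective (fun v : 'cV[K]_eps => emb (picket K eps m) *m v).
Proof.
case: eps => [|[|//]] _ lem u v; first by rewrite !flatmx0.
move=> /matrixP/(_ (Ordinal (ltac:(lia) : (m.-1 < m)%N)) 0).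
rewrite !mxE !big_ord1 !mxE /= prednK // eqxx !mul1r => uv.
by apply/matrixP => i j; rewrite !ord1.
Qed.

Lemma picket_hom eps m : (eps <= 1)%N -> (eps <= m)%N ->
  emb (picket K eps m) *m cyclicT K eps = cyclicT K m *m emb (picket K eps m).
Proof.
case: eps => [|[|//]] _ lem; first by apply/matrixP => i [].
have -> : cyclicT K 1 = 0 by apply/matrixP => i j; rewrite !mxE !ord1.
rewrite mulmx0; apply/matrixP => i j; rewrite !mxE big1 // => k _; rewrite !mxE.
have [ek|_] := eqVneq k.+1 m; last by rewrite mulr0.
by rewrite mulr1 ltn_eqF // ek.
Qed.

Lemma picket_object eps m : (eps <= 1)%N -> (eps <= m)%N ->
  exists Z : Sobj K, isomorphic (triple_of Z) (picket K eps m).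
Proof.
move=> le1 lem.
have [al [Ja [Ja' [ja ja' Ta]]]] := partition_of_part eps.
have [be [Jb [Jb' [jb jb' Tb]]]] := partition_of_part m.
have Ta' : Ja' *m NT K al = cyclicT K eps *m Ja'.
  by rewrite -[LHS]mulmx1 -ja mulmxA -(mulmxA Ja') Ta !mulmxA ja' mul1mx.
have Tb' : Jb' *m NT K be = cyclicT K m *m Jb'.
  by rewrite -[LHS]mulmx1 -jb mulmxA -(mulmxA Jb') Tb !mulmxA jb' mul1mx.
pose f := Jb *m emb (picket K eps m) *m Ja'.
have f_lin : f *m NT K al = NT K be *m f.
  by rewrite /f !mulmxA Tb -!mulmxA Ta' (mulmxA _ (cyclicT K eps)) picket_hom // !mulmxA.
have f_inj : injective (fun v : 'cV[K]_(weight al) => f *m v).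
  move=> u v /(congr1 (mulmx Jb')); rewrite /f !mulmxA jb' mul1mx -!mulmxA.
  move=> /(picket_emb_inj le1 lem) /(congr1 (mulmx Ja)).
  by rewrite !mulmxA ja !mul1mx.
exists (SObj f_lin f_inj), (Ja', Jb'), (Ja, Jb); split=> //; split=> //=.
- by rewrite /f !mulmxA jb' mul1mx.
- by rewrite /f -!mulmxA ja' mulmx1.
Qed.

End PicketObjects.

Section Types.
Variable K : fieldType.

Lemma cyclicT_le1 m : (m <= 1)%N -> cyclicT K m = 0.
Proof.
case: m => [|[|//]] _; apply/matrixP => i j; first by case: i.
by rewrite !mxE !ord1.
Qed.

Lemma NT_eq0 lam : (part lam 0 <= 1)%N -> NT K lam = 0.
Proof.
move=> le1; rewrite /NT -mxdiag0; apply: eq_mxdiag => i; apply: cyclicT_le1.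
exact: leq_trans (sorted_geq_nth (partition_sorted lam) (leq0n i)) le1.
Qed.

Lemma triple_of_point a b (X : Sab K a b) :
  triple_of (Sab_obj X) = point_triple (point_of X).
Proof.
case: X => -[al be f lin inj] /= le1 ea eb; case: _ / ea; case: _ / eb.
by rewrite /point_of /triple_of /point_triple /= !castmx_id NT_eq0.
Qed.

Lemma NT_nilpotent lam : exists N, forall x, iter N (mulmx (NT K lam)) x = 0 :> 'cV_(weight lam).
Proof.
pose X (i : 'I_(size lam)) := picket K 0 (part lam i).
have cb i := @chain_basis_picket K 0 (part lam i) isT isT.
have [nil0 _ _] := chain_basis_variety (chain_basis_dsum (X := X) cb).
by exists (weight lam) => x; rewrite iter_mulmxX [X in X *m _]nil0 mul0mx.
Qed.

Lemma inj_left_inverse m n (f : 'M[K]_(m, n)) :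
  injective (fun v : 'cV[K]_n => f *m v) -> exists M, M *m f = 1%:M.
Proof.
move=> inj_f; apply/row_fullP.
have coker0 : cokermx f = 0.
  apply/matrixP => i j; have : f *m col j (cokermx f) = f *m 0.
    by rewrite mulmx0 colE mulmxA mulmx_coker mul0mx.
  by move=> /inj_f/matrixP/(_ i 0); rewrite !mxE.
have := mxrank_coker f; rewrite coker0 mxrank0 => /esym/eqP.
by rewrite subn_eq0 => le_n; rewrite /row_full eqn_leq le_n rank_leq_col.
Qed.

Lemma Sab_code a b (X : Sab K a b) :
  exists s, has_code (point_of X).1 (point_of X).2 s.
Proof.
case: X => -[al be f lin inj] /= le1 ea eb; case: _ / ea; case: _ / eb.
rewrite /point_of /= !castmx_id; have [N nilN] := NT_nilpotent be.
apply: code_of_point nilN _ (inj_left_inverse inj).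
by rewrite -lin NT_eq0 // mulmx0.
Qed.

Lemma code_dsum be ga : interlaced be ga ->
  has_code
    (emb (dsum (fun i : 'I_(size be) => picket K (part be i - part ga i) (part be i))))
    (T2 (dsum (fun i : 'I_(size be) => picket K (part be i - part ga i) (part be i))))
    (code be ga).
Proof.
move=> il.
have -> : code be ga
    = [seq ((part be i).*2 - (part be i - part ga i))%N | i : 'I_(size be) <- enum 'I_(size be)].
  rewrite /code -val_enum_ord -map_comp; apply: eq_map => i /=.
  by have := il i; lia.
apply: (@has_code_dsum_picket K _ (fun i => part be i - part ga i)%N (fun i => part be i)) => i.
  by have := il i; lia.
exact: leq_subr.
Qed.

Lemma has_type_code a b (X : Sab K a b) be ga :
  has_type (Sab_obj X) be ga ->
  interlaced be ga /\ has_code (point_of X).1 (point_of X).2 (code be ga).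
Proof.
case=> il; rewrite triple_of_point => -[psi [chi [_ [/= _ h2 h3] [e1 e1'] [e2 e2']]]].
by split=> //; apply: (has_code_transport h2 (esym h3) e2 e2' e1 e1'); apply: code_dsum.
Qed.

Lemma code_has_type a b (X : Sab K a b) be ga :
  interlaced be ga -> has_code (point_of X).1 (point_of X).2 (code be ga) ->
  has_type (Sab_obj X) be ga.
Proof.
move=> il /has_codeP[L cL eL]; have [L' cL' eL'] := has_codeP (code_dsum il).
split=> //; rewrite triple_of_point.
have [g [h [g' [h' [p1 p2 p3 p4 [e1 e2 e3 e4]]]]]] := chain_iso cL cL' (etrans eL (esym eL')).
have T1D : T1 (dsum (fun i : 'I_(size be) => picket K (part be i - part ga i) (part be i))) = 0.
  rewrite /= -[RHS]mxdiag0; apply: eq_mxdiag => i; apply: cyclicT_le1.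
  by have := il i; lia.
exists (g, h), (g', h'); split=> //; split=> //=.
- by rewrite mulmx0 [X in X *m _]T1D mul0mx.
- by rewrite mul0mx [X in _ *m X]T1D mulmx0.
Qed.

Lemma has_code_perm a b (f : 'M[K]_(b, a)) phi s s' :
  has_code f phi s -> perm_eq (nzparts s) (nzparts s') -> has_code f phi s'.
Proof. by move=> [L cL pL] ps; exists L => //; apply: perm_trans ps. Qed.

(** For fixed dimensions [a] and [b], the dimensions of the homomorphisms from
    [P_0^m] and [P_1^m] are constants minus the tail sums at [2m] and [2m - 1]. *)
Lemma hom_le_tailsum a b (X Y : Sab K a b) s s' :
    has_code (point_of X).1 (point_of X).2 s ->
    has_code (point_of Y).1 (point_of Y).2 s' ->
    hom_le X Y ->
  forall n, (tailsum n s' <= tailsum n s)%N.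
Proof.
move=> hX hY homXY.
have homP eps m : (eps <= 1)%N -> (0 < m)%N ->
    (\dim (HomS (picket K eps m) (point_triple (point_of X)))
     <= \dim (HomS (picket K eps m) (point_triple (point_of Y))))%N.
  move=> le1 m_gt0; have [|Z isoZ] := picket_object K (eps := eps) (m := m) le1.
    exact: leq_trans le1 m_gt0.
  by rewrite -!(isomorphic_dim_hom _ isoZ) -!triple_of_point; apply: homXY.
have [e0X e1X] := has_code_dims hX; have [e0Y e1Y] := has_code_dims hY.
have vX := has_code_variety hX; have vY := has_code_variety hY.
have [LX cX eX] := has_codeP hX; have [LY cY eY] := has_codeP hY.
have le_even m : (tailsum m.*2 s' <= tailsum m.*2 s)%N.
  have [->|m_gt0] := posnP m; first by rewrite double0 e0X e0Y.
  have := homP 0%N m isT m_gt0.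
  have := dim_hom_picket0 (point_of X).1 (point_of X).2 m_gt0.
  have := dim_hom_picket0 (point_of Y).1 (point_of Y).2 m_gt0.
  rewrite (dim_limg_power cX) (dim_limg_power cY) eX eY !tailsum_nzparts.
  rewrite -!surjective_pairing.
  move: (\dim _) (\dim _) => dX dY; lia.
have le_odd m : (tailsum m.*2.+1 s' <= tailsum m.*2.+1 s)%N.
  have := homP 1%N m.+1 isT isT.
  have [_ zX _] := vX; have [_ zY _] := vY.
  have := @dim_hom_picket1 K a b _ _ m.+1 isT zX.
  have := @dim_hom_picket1 K a b _ _ m.+1 isT zY.
  rewrite (dim_limg_rel_map cX) (dim_limg_rel_map cY) eX eY !tailsum_nzparts succnK.
  rewrite -!surjective_pairing.
  move: (\dim _) (\dim _) => dX dY; lia.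
by move=> n; rewrite -[n]odd_double_half; case: (odd n); rewrite ?add1n ?add0n.
Qed.

End Types.

Theorem theorem4p4 (K : closedFieldType) (a b : nat) (X Y : Sab K a b) :
  [<-> dom_le X Y; deg_le X Y; hom_le X Y].
Proof.
have [sX hX] := Sab_code X; have [sY hY] := Sab_code Y.
tfae.
- move=> [beX [gaX [beY [gaY [tX tY le_be le_ga]]]]] p oYp.
  have [ilX cX] := has_type_code tX; have [ilY cY] := has_type_code tY.
  have [le_n eq0 eq1] := (tailsum_code_dom ilX ilY).1 (conj le_be le_ga).
  exact: dom_closure cX (has_code_orbit cY oYp) le_n eq0 eq1.
- move=> degXY Z; rewrite !triple_of_point.
  apply: closure_dim_hom; first exact: has_code_variety hX.
  apply: degXY; exists 1%:M, 1%:M; rewrite !unitmx1; split=> //.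
  by rewrite /GL_act !mul1mx !invmx1 !mulmx1 -surjective_pairing.
- move=> homXY; have le_n := hom_le_tailsum hX hY homXY.
  have [beX [gaX [ilX pX]]] := code_surj sX; have [beY [gaY [ilY pY]]] := code_surj sY.
  have nz s : nzparts (nzparts s) = nzparts s by exact: filter_id.
  exists beX, gaX, beY, gaY.
  have tX n : tailsum n (code beX gaX) = tailsum n sX.
    by rewrite (perm_tailsum _ pX) tailsum_nzparts.
  have tY n : tailsum n (code beY gaY) = tailsum n sY.
    by rewrite (perm_tailsum _ pY) tailsum_nzparts.
  have [e0X e1X] := has_code_dims hX; have [e0Y e1Y] := has_code_dims hY.
  have [|dbe dga] := (tailsum_code_dom ilX ilY).2 _.
    by split=> [n||]; rewrite tX tY //; [rewrite e0X e0Y | lia].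
  split=> //; apply: code_has_type => //; apply: has_code_perm; try exact: hX; try exact: hY.
    by have := perm_filter (fun c => c != 0%N) pX; rewrite perm_sym -/(nzparts _) nz.
  by have := perm_filter (fun c => c != 0%N) pY; rewrite perm_sym -/(nzparts _) nz.
Qed.
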